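(* Every upward planar graph on $n$ vertices has page number $\mathcal{O}(n^{2/3}\log^{2/3}(n))$; that is, there is an absolute constant $C$ such that for every $n\geq 2$ and every upward planar graph $G$ on $n$ vertices, $\operatorname{pn}(G)\leq C\, n^{2/3}(\log n)^{2/3}$.
   Context: All graphs are finite and directed. A directed acyclic graph $G$ is upward planar if it has a drawing in the Euclidean plane in which vertices are points, every edge $(u,v)$ is a strictly $y$-monotone curve with lower endpoint $u$ and upper endpoint $v$, and every edge is disjoint from other points and curves except in its endpoints. Given a topological ordering $<$ of $G$ (a linear ordering of the vertices with $u<v$ for every edge $(u,v)$), two edges $(u_1,v_1),(u_2,v_2)$ cross if $u_1<u_2<v_1<v_2$ or $u_2<u_1<v_2<v_1$. A book embedding of $G$ with $k$ pages consists of a topological ordering $<$ of $G$ (the spine ordering) and a partition of $E(G)$ into $k$ sets (pages) such that no page contains two edges that cross with respect to $<$. The page number $\operatorname{pn}(G)$ is the minimum $k$ for which $G$ admits a book embedding with $k$ pages. *)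

(* Defs.v *)
From HB Require Import structures.
From mathcomp Require Import all_boot all_order all_algebra.
From mathcomp Require Import all_classical all_reals all_analysis.

Set Implicit Arguments.
Unset Strict Implicit.
Unset Printing Implicit Defensive.

Import Order.TTheory GRing.Theory Num.Theory.
Import numFieldNormedType.Exports.

(* [cycle edge c] says that [c] is a closed walk, so loops are excluded too. *)
Record dag := Dag {
  vertex :> finType;
  edge : rel vertex;
  dag_acyclic : forall c : seq vertex, cycle edge c -> c = [::]
}.

Section BookEmbedding.
Variable G : dag.
Implicit Types (lt : rel G) (e f : G * G) (k : nat).

Definition strict_linear_order lt : Prop :=
  [/\ irreflexive lt, transitive lt & forall u v, u != v -> lt u v || lt v u].

Definition topological_ordering lt : Prop :=
  strict_linear_order lt /\ forall u v : G, edge u v -> lt u v.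

Definition cross lt e f : bool :=
  [&& lt e.1 f.1, lt f.1 e.2 & lt e.2 f.2] ||
  [&& lt f.1 e.1, lt e.1 f.2 & lt f.2 e.2].

(* The partition of the edges into [k] pages is given by the index
   [page e < k] of the page of each edge; values on non-edges are irrelevant.
   Taking [nat] rather than ['I_k] as codomain lets an edgeless graph have a
   book embedding with 0 pages. *)
Definition book_embedding k lt (page : G * G -> nat) : Prop :=
  [/\ topological_ordering lt,
      forall e, edge e.1 e.2 -> page e < k
    & forall e f, edge e.1 e.2 -> edge f.1 f.2 -> page e = page f ->
        ~~ cross lt e f].

Definition has_book_embedding k : Prop :=
  exists lt (page : G * G -> nat), book_embedding k lt page.

Let height (v : G) : nat := #|[set u | connect (@edge G) u v]|.

Let edge_height (u v : G) : edge u v -> height u < height v.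
Proof.
move=> uv; apply/proper_card/properP; split.
  apply/fintype.subsetP => w; rewrite !inE => wu.
  exact: connect_trans wu (connect1 uv).
exists v; rewrite inE ?connect0//; apply/negP => /connectP[p pp pE].
suff : u :: belast v p = [::] by [].
apply: (@dag_acyclic G); rewrite /cycle.
have -> : rcons (belast v p) u = v :: p by rewrite lastI pE.
by rewrite /= uv.
Qed.

Lemma dag_has_book_embedding : exists k, `[< has_book_embedding k >].
Proof.
pose lt : rel G := fun u v => (height u < height v) ||
  ((height u == height v) && (enum_rank u < enum_rank v)).
have lti : irreflexive lt by move=> u; rewrite /lt !ltnn eqxx.
exists #|{: G * G}|; apply/asboolP; exists lt, (fun e => enum_rank e : nat).
split; first split; first split=> //.
- move=> v u w /orP[uv|/andP[/eqP uv ruv]] /orP[vw|/andP[/eqP vw rvw]];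
    rewrite /lt.
  + by rewrite (ltn_trans uv vw).
  + by rewrite -vw uv.
  + by rewrite uv vw.
  + by rewrite uv vw eqxx (ltn_trans ruv rvw) orbT.
- move=> u v uv; rewrite /lt.
  case: (ltngtP (height u) (height v)) => //= _.
  case: (ltngtP (enum_rank u) (enum_rank v)) => //= r.
  by move/val_inj/enum_rank_inj: r uv => ->; rewrite eqxx.
- by move=> u v /edge_height; rewrite /lt => ->.
- by move=> e _; exact: ltn_ord.
- by move=> e f _ _ /val_inj/enum_rank_inj ->; rewrite /cross lti.
Qed.

Definition page_number : nat := ex_minn dag_has_book_embedding.

End BookEmbedding.

Section UpwardPlanar.
Local Open Scope classical_set_scope.
Local Open Scope ring_scope.
Variable R : realType.

(* A strictly y-monotone curve, parametrised over [0, 1], with lower endpoint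
   [p] and upper endpoint [q]. *)
Definition upward_curve (p q : R * R) (c : R -> R * R) : Prop :=
  [/\ {within `[0, 1], continuous c}, c 0 = p, c 1 = q
    & forall s t : R, 0 <= s -> s < t -> t <= 1 -> (c s).2 < (c t).2].

Definition curve_image (c : R -> R * R) : set (R * R) := c @` `[0, 1].

(* [curve (u, v)] is only meaningful when [(u, v)] is an edge. *)
Definition upward_planar_drawing (G : dag) (pos : G -> R * R)
    (curve : G * G -> R -> R * R) : Prop :=
  [/\ injective pos,
      forall e, edge e.1 e.2 -> upward_curve (pos e.1) (pos e.2) (curve e),
      forall e w, edge e.1 e.2 -> curve_image (curve e) (pos w) ->
        w = e.1 \/ w = e.2
    & forall e f, edge e.1 e.2 -> edge f.1 f.2 -> e <> f ->
        curve_image (curve e) `&` curve_image (curve f) `<=`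
        [set pos e.1; pos e.2] `&` [set pos f.1; pos f.2]].

Definition upward_planar (G : dag) : Prop :=
  exists (pos : G -> R * R) (curve : G * G -> R -> R * R),
    upward_planar_drawing pos curve.

End UpwardPlanar.

(* Main.v *)
Require Import Defs.
From mathcomp Require Import all_boot all_order all_algebra.
From mathcomp Require Import all_classical all_reals all_analysis.
From mathcomp Require Import ring lra zify.

Set Implicit Arguments.
Unset Strict Implicit.
Unset Printing Implicit Defensive.

Import Order.TTheory GRing.Theory Num.Theory.
Import numFieldNormedType.Exports.
Local Open Scope ring_scope.

(* A drawing induces two conjugate partial orders on vertices and edges: the
   reachability order of a planar st-graph containing the given graph, and the
   relation "to the left of". Together they give coordinates x (left-first order)
   and y (right-first order). In the spine ordering by x, three pairwise crossing
   edges are never increasing from left to right, so a large twist is a ladder: two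
   increasing chains joined by rungs leading from the left one to the right one.
   Without ladders of size T, the edges need O(T log n) pages.

   A ladder of size T is destroyed by a barrier, which forces the head of a lower
   rung before the tail of a higher rung, at the price of paying for the edges
   crossing the barrier. Paid edges split into classes that fit into 4 pages in
   every further linear extension. If all barriers of a ladder cost at least m, then
   its gaps contain many vertices, and the barrier makes about m T^2 new pairs of
   vertices comparable. As there are at most n^2 pairs, only O(n^2 / T^2) pages are
   spent on paid edges, and T = n^(2/3) / (log n)^(1/3) balances both terms. *)

(** * Planar orders in coordinates *)

Section Structure.
Variables V E : finType.
Local Notation W := (V + E)%type.
Implicit Types (t h : E -> V) (A : {set E}) (x y : W -> int) (u v w : W) (e f g : E).

Definition below x y u v := (x u < x v) && (y u < y v).
Definition left_of x y u v := (x u < x v) && (y v < y u).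
Definition weakly_below x y u v := (x u <= x v) && (y u <= y v).

Definition alive A w := if w is inr e then e \in A else true.

(* [t] and [h] are the tail and head maps. An edge is an element of its own, lying
   between its endpoints in the order [below]; edges outside [A] are ignored. *)
Record planar t h A x y : Prop := Planar {
  planar_injx : {in alive A &, injective x};
  planar_injy : {in alive A &, injective y};
  planar_tail : forall e, e \in A -> below x y (inl (t e)) (inr e);
  planar_head : forall e, e \in A -> below x y (inr e) (inl (h e));
  planar_below : forall e w, e \in A -> alive A w ->
    below x y w (inr e) -> weakly_below x y w (inl (t e));
  planar_above : forall e w, e \in A -> alive A w ->
    below x y (inr e) w -> weakly_below x y (inl (h e)) w }.

(* Rungs are listed from bottom to top, hence from right to left. *)
Record ladder t h A x y T (r : nat -> E) : Prop := Ladder {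
  ladder_alive : forall i, (i < T)%N -> r i \in A;
  ladder_tails : forall i j, (i < j < T)%N -> x (inl (t (r i))) < x (inl (t (r j)));
  ladder_heads : forall i j, (i < j < T)%N -> x (inl (h (r i))) < x (inl (h (r j)));
  ladder_left : forall i j, (i < j < T)%N -> left_of x y (inr (r j)) (inr (r i)) }.

(** A half-turn of the drawing, under which tails and heads swap roles. It carries statements about
    the lower side of a ladder over to its upper side. *)
Lemma planar_dual t h A x y : planar t h A x y ->
  planar h t A (fun w => - x w) (fun w => - y w).
Proof.
move=> [ix iy pt ph pb pa]; split.
- by move=> u v ? ? /oppr_inj; apply: ix.
- by move=> u v ? ? /oppr_inj; apply: iy.
- by move=> e /ph; rewrite /below; lia.
- by move=> e /pt; rewrite /below; lia.
- by move=> e w eA wA; have := pa e w eA wA; rewrite /below /weakly_below; lia.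
- by move=> e w eA wA; have := pb e w eA wA; rewrite /below /weakly_below; lia.
Qed.

Lemma ladder_dual t h A x y T r : ladder t h A x y T r ->
  ladder h t A (fun w => - x w) (fun w => - y w) T (fun i => r (T - i.+1)%N).
Proof.
move=> [la lt lh ll]; split.
- by move=> i iT; apply: la; lia.
- by move=> i j ij; rewrite ltrN2; apply: lh; lia.
- by move=> i j ij; rewrite ltrN2; apply: lt; lia.
- move=> i j ij; have : (T - j.+1 < T - i.+1 < T)%N by lia.
  by move=> /ll; rewrite /left_of; lia.
Qed.

End Structure.

Section PlanarFacts.
Variables (V E : finType) (t h : E -> V) (A : {set E}) (x y : V + E -> int).
Hypothesis P : planar t h A x y.

Lemma planar_eq u v : alive A u -> alive A v -> (x u == x v) = (y u == y v).
Proof.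
move=> au av; apply/eqP/eqP => [/(planar_injx P au av)->|] //.
by move=> /(planar_injy P au av)->.
Qed.

Lemma planar_vertex_edge v e : e \in A ->
  (x (inl v) != x (inr e)) && (y (inl v) != y (inr e)).
Proof.
move=> eA; apply/andP; split; apply/eqP.
  by move/(@planar_injx _ _ _ _ _ _ _ P (inl v) (inr e) isT eA).
by move/(@planar_injy _ _ _ _ _ _ _ P (inl v) (inr e) isT eA).
Qed.

Lemma planar_weakly_below u v : alive A u -> alive A v ->
  weakly_below x y u v = (u == v) || below x y u v.
Proof.
move=> au av; have [->|uv] := eqVneq u v; first by rewrite /weakly_below !lexx.
have : (x u != x v) by apply: contra uv => /eqP /(planar_injx P au av)->.
have := planar_eq au av.
by rewrite /weakly_below /below; lia.
Qed.

Variables (T : nat) (r : nat -> E).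
Hypothesis L : ladder t h A x y T r.

(** The tail of [r i] is below the edge [r j], and what is below an edge is weakly below its
    tail. *)
Lemma ladder_tails_below i j : (i < j < T)%N ->
  below x y (inl (t (r i))) (inl (t (r j))).
Proof.
move=> ij; have [iT jT] : (i < T /\ j < T)%N by lia.
have iA := ladder_alive L iT; have jA := ladder_alive L jT.
have := ladder_tails L ij; have := ladder_left L ij.
have := planar_tail P iA; have := planar_tail P jA.
have := planar_below P jA (w := inl (t (r i))) isT.
have := planar_eq (u := inl (t (r i))) (v := inl (t (r j))) isT isT.
have := planar_vertex_edge (t (r i)) jA.
by rewrite /below /left_of /weakly_below; lia.
Qed.

Lemma ladder_heads_below i j : (i < j < T)%N ->
  below x y (inl (h (r i))) (inl (h (r j))).
Proof.
move=> ij; have [iT jT] : (i < T /\ j < T)%N by lia.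
have iA := ladder_alive L iT; have jA := ladder_alive L jT.
have := ladder_heads L ij; have := ladder_left L ij.
have := planar_head P iA; have := planar_head P jA.
have := planar_above P iA (w := inl (h (r j))) isT.
have := planar_eq (u := inl (h (r i))) (v := inl (h (r j))) isT isT.
have := planar_vertex_edge (h (r j)) iA.
by rewrite /below /left_of /weakly_below; lia.
Qed.

(** Otherwise the tail of [r j] would be below [r i], hence weakly below the tail of [r i], against
    the order of the tails. *)
Lemma ladder_tail_left i j : (i < j < T)%N ->
  left_of x y (inl (t (r j))) (inr (r i)).
Proof.
move=> ij; have [iT jT] : (i < T /\ j < T)%N by lia.
have iA := ladder_alive L iT; have jA := ladder_alive L jT.
have := ladder_tails L ij; have := ladder_left L ij.
have := planar_tail P jA.
have := planar_below P iA (w := inl (t (r j))) isT.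
have := planar_vertex_edge (t (r j)) iA.
by rewrite /below /left_of /weakly_below; lia.
Qed.

Lemma ladder_head_right i j : (i < j < T)%N ->
  left_of x y (inr (r j)) (inl (h (r i))).
Proof.
move=> ij; have [iT jT] : (i < T /\ j < T)%N by lia.
have iA := ladder_alive L iT; have jA := ladder_alive L jT.
have := ladder_heads L ij; have := ladder_left L ij.
have := planar_head P iA.
have := planar_above P jA (w := inl (h (r i))) isT.
have := planar_vertex_edge (h (r i)) jA.
by rewrite /below /left_of /weakly_below; lia.
Qed.

Lemma left_of_trans v u w : left_of x y u v -> left_of x y v w -> left_of x y u w.
Proof. by rewrite /left_of; lia. Qed.

(** The rung [i.+1] separates the two vertices, which is why gaps will span two steps of the
    ladder. *)
Lemma ladder_tail_left_head i j : (i.+1 < j < T)%N ->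
  left_of x y (inl (t (r j))) (inl (h (r i))).
Proof.
move=> ij; apply: (@left_of_trans (inr (r i.+1))).
  by apply: ladder_tail_left; lia.
by apply: ladder_head_right; lia.
Qed.

End PlanarFacts.

(** * Barriers *)

(* The barrier forces everything under [D] to precede [p]: elements to the right of
   [p] that are not under [D] are moved after all others, keeping their order. The
   y-coordinate is unaffected because [p] is to the left of [D]. *)
Section Barrier.
Variables (V E : finType) (t h : E -> V) (A A' : {set E}) (x y : V + E -> int).
Hypothesis P : planar t h A x y.
Variables (p : V) (D : {set V}).
Implicit Types (u v w : V + E) (d : V) (e : E).

Definition under w := [exists d in D, weakly_below x y w (inl d)].

(** The offset exceeds the difference of any two x-coordinates. *)
Definition shifted w : int :=
  if under w then x w
  else if x (inl p) <= x w then x w + (\max_u `|x u|).*2.+1%:Z else x w.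

Lemma x_bound u : `|x u| <= (\max_u `|x u|)%:Z.
Proof. by rewrite -abszE lez_nat; apply: leq_bigmax. Qed.

Lemma under_below u v : below x y u v -> under v -> under u.
Proof.
move=> uv /existsP[d /andP[dD vd]]; apply/existsP; exists d; rewrite dD /=.
by move: uv vd; rewrite /below /weakly_below; lia.
Qed.

(** What is under [D] is closed downwards, so if [u] is moved then so is every [v] above it. *)
Lemma shifted_below u v : below x y u v -> below shifted y u v.
Proof.
move=> uv; have := @under_below _ _ uv; move: uv.
have := x_bound u; have := x_bound v; rewrite /below /shifted.
by case: (under u); case: (under v); do ?case: ifP; lia.
Qed.

Hypothesis pD : forall d, d \in D -> left_of x y (inl p) (inl d).

Lemma under_not_above v : under v -> ~~ weakly_below x y (inl p) v.
Proof.
by move=> /existsP[d /andP[/pD]]; rewrite /left_of /weakly_below; lia.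
Qed.

Lemma shifted_new u v : under u -> weakly_below x y (inl p) v ->
  below shifted y u v.
Proof.
move=> uN pv; have /negbTE vN : ~~ under v by apply: contraL pv => /under_not_above.
move: (uN) pv => /existsP[d /andP[/pD]].
have := x_bound u; have := x_bound v.
rewrite /below /shifted uN vN /left_of /weakly_below => ub vb pd ud pv.
by have -> : x (inl p) <= x v; lia.
Qed.

Hypothesis subA : A' \subset A.
Hypothesis convex : forall w d, alive A' w -> d \in D ->
  left_of x y (inl p) w -> left_of x y w (inl d) -> under w.

Lemma alive_sub w : alive A' w -> alive A w.
Proof. by case: w => // e; apply: (fintype.subsetP subA). Qed.

(** A new relation needs [u] under some [d] and [v] moved. If [v] were not weakly above [p], it
    would lie between [p] and [d] from left to right, hence under [D] by [convex], and would not
    have been moved. *)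
Lemma shiftedE u v : alive A' u -> alive A' v ->
  below shifted y u v = below x y u v || (under u && weakly_below x y (inl p) v).
Proof.
move=> u' v'; have au := alive_sub u'; have av := alive_sub v'.
apply/idP/idP => [uv|/orP[/shifted_below//|/andP[? ?]]]; last exact: shifted_new.
apply/negP => /negP; rewrite negb_or negb_and => /andP[nuv new].
have := planar_eq P au av; have := planar_eq P (u := inl p) (v := v) isT av.
have := @convex v; move: uv nuv new; rewrite /below /shifted.
have := x_bound u; have := x_bound v.
case vN: (under v).
  by case uN : (under u); do ?case: ifP; rewrite /= /weakly_below; lia.
case uN: (under u) => /=; last by do ?case: ifP; lia.
have /existsP[d /andP[dD ud]] : is_true (under u) by rewrite uN.
move=> _ _ xy nxy pv /(_ d v' dD) cv vp uv.
have vd : ~~ weakly_below x y v (inl d).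
  by apply: contraFN vN => vd; apply/existsP; exists d; rewrite dD.
move: ud xy nxy pv cv vp uv vd; rewrite /left_of /weakly_below.
by do ?case: ifP; lia.
Qed.

(** If [w] becomes below [e] because [w] is under [D] and [e] is above [p], then the tail of [e] is
    weakly above [p] as well, so [w] also becomes below that tail. Symmetrically, if [e] is under
    [D], then so is its head. *)
Lemma barrier_planar : planar t h A' shifted y.
Proof.
have A'A e : e \in A' -> e \in A by move/(fintype.subsetP subA).
split.
- move=> u v u' v'; have au := alive_sub u'; have av := alive_sub v'.
  move=> /eqP xuv; apply: (planar_injx P au av); apply/eqP; move: xuv.
  have := planar_eq P au av; have := x_bound u; have := x_bound v.
  have := planar_eq P (u := inl p) (v := v) isT av.
  have := planar_eq P (u := inl p) (v := u) isT au.
  rewrite /shifted; case uN: (under u); case vN: (under v); do ?case: ifP; lia.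
- by move=> u v /alive_sub au /alive_sub av; apply: (planar_injy P).
- by move=> e /A'A /(planar_tail P)/shifted_below.
- by move=> e /A'A /(planar_head P)/shifted_below.
- move=> e w e' w'; have eA := A'A _ e'; rewrite shiftedE //.
  case/orP=> [we|/andP[wN pe]].
    have := planar_below P eA (alive_sub w') we.
    rewrite (planar_weakly_below P (alive_sub w'))// => /orP[/eqP->|].
      by rewrite /weakly_below !lexx.
    by move=> /shifted_below; rewrite /below /weakly_below; lia.
  have : below shifted y w (inl (t e)).
    apply: shifted_new wN _; apply: (planar_below P eA) => //.
    move: pe; rewrite (planar_weakly_below P (u := inl p) (v := inr e)) //.
  by rewrite /below /weakly_below; lia.
- move=> e w e' w'; have eA := A'A _ e'; rewrite shiftedE //.
  case/orP=> [we|/andP[wN pe]].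
    have := planar_above P eA (alive_sub w') we.
    rewrite (planar_weakly_below P _ (alive_sub w'))// => /orP[/eqP<-|].
      by rewrite /weakly_below !lexx.
    by move=> /shifted_below; rewrite /below /weakly_below; lia.
  have : below shifted y (inl (h e)) w.
    apply: shifted_new pe; move: wN => /existsP[d /andP[dD ed]].
    apply/existsP; exists d; rewrite dD; apply: (planar_above P eA) => //.
    by move: ed; rewrite (planar_weakly_below P (u := inr e) (v := inl d)).
  by rewrite /below /weakly_below; lia.
Qed.

End Barrier.

(** * Chains, and pages for the edges crossing a barrier *)

Lemma strict_order_rank (E : finType) (r : rel E) : irreflexive r -> transitive r ->
  exists rk : E -> nat, (forall e f, r e f -> (rk e < rk f)%N) /\
    forall e, exists s, size s = rk e /\ sorted r (rcons s e).
Proof.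
move=> irr tr.
(* As in the proof of Mirsky's theorem, the rank of [e] is the largest number of elements preceding
   [e] in a chain that ends with [e]. *)
pose chain e k := `[< exists s, size s = k /\ sorted r (rcons s e) >].
have chain0 e : exists k, chain e k by exists 0; apply/asboolP; exists [::].
have chain_le e k : chain e k -> (k <= #|E|)%N.
  move=> /asboolP[s [<- /(sorted_uniq tr irr)/card_uniqP]].
  by rewrite size_rcons => es; apply: ltnW; rewrite -es max_card.
exists (fun e => ex_maxn (chain0 e) (@chain_le e)); split=> [e f ef|e]; last first.
  by case: ex_maxnP => k /asboolP[s es] _; exists s.
case: ex_maxnP => k /asboolP[s [sk ss]] _; case: ex_maxnP => k' _; apply.
apply/asboolP; exists (rcons s e); rewrite size_rcons sk; split=> //.
by case: s ss {sk} => [|a s] /= ss; rewrite ?ef// rcons_path last_rcons ef ss.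
Qed.

Definition crosses (V E : Type) (t h : E -> V) (z : V -> int) (e f : E) :=
  [&& z (t e) < z (t f), z (t f) < z (h e) & z (h e) < z (h f)].

Definition extends (V E : finType) (x y : V + E -> int) (z : V -> int) :=
  forall u v, below x y (inl u) (inl v) -> z u < z v.

Section CrossingEdges.
Variables (V E : finType) (t h : E -> V) (A C : {set E}) (x y : V + E -> int).
Hypothesis P : planar t h A x y.
Variable p : V.
Hypothesis CA : C \subset A.
Hypothesis Cp : forall e, e \in C ->
  left_of x y (inl p) (inr e) && below x y (inl p) (inl (h e)).

Definition precedes e f := [&& e \in C, f \in C & x (inl (h e)) <= x (inl (t f))].

Let CA' e : e \in C -> e \in A.
Proof. exact: (fintype.subsetP CA). Qed.

Lemma precedes_irr : irreflexive precedes.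
Proof.
move=> e; apply/negP => /and3P[/CA' eA _].
by have := planar_tail P eA; have := planar_head P eA; rewrite /below; lia.
Qed.

Lemma precedes_trans : transitive precedes.
Proof.
move=> f e g /and3P[eC fC ef] /and3P[_ gC fg]; apply/and3P; split=> //.
by have := planar_tail P (CA' fC); have := planar_head P (CA' fC); rewrite /below; lia.
Qed.

(** Otherwise [e] is below [f], so the head of [e] and with it [p] are below [f], although [p] is
    left of [f]. *)
Lemma crossing_edges_left e f : e \in C -> f \in C -> x (inr e) < x (inr f) ->
  y (inr f) < y (inr e).
Proof.
move=> eC fC ef; have eA := CA' eC; have fA := CA' fC.
have := Cp eC; have := Cp fC; have := planar_above P eA (w := inr f) fA.
have := planar_eq P (u := inr e) (v := inr f) eA fA.
by rewrite /left_of /below /weakly_below; lia.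
Qed.

Lemma crossing_edges_head e f : e \in C -> f \in C -> x (inr e) < x (inr f) ->
  weakly_below x y (inl (h f)) (inl (h e)) || (x (inl (h e)) < x (inr f)).
Proof.
move=> eC fC ef; have := crossing_edges_left eC fC ef.
have := planar_above P (CA' fC) (w := inl (h e)) isT; move: ef.
have := planar_head P (CA' eC); have := planar_vertex_edge P (h e) (CA' fC).
by rewrite /below /weakly_below; lia.
Qed.

Lemma crossing_edges_tail e f : e \in C -> f \in C -> x (inr e) < x (inr f) ->
  weakly_below x y (inl (t f)) (inl (t e)) || (x (inr e) < x (inl (t f))).
Proof.
move=> eC fC ef; have := crossing_edges_left eC fC ef.
have := planar_below P (CA' eC) (w := inl (t f)) isT; move: ef.
have := planar_tail P (CA' fC); have := planar_vertex_edge P (t f) (CA' eC).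
by rewrite /below /weakly_below; lia.
Qed.

(** By [Cp], [p] is higher than [f] and lower than [h g] in the y-coordinate, so [f] is below [h g],
    and what is above an edge is weakly above its head. *)
Lemma crossing_edges_middle e f g : e \in C -> f \in C -> g \in C ->
  x (inr e) < x (inr f) -> x (inr f) < x (inr g) ->
  weakly_below x y (inl (t e)) (inl (t f)) || weakly_below x y (inl (h f)) (inl (h g)).
Proof.
move=> eC fC gC ef fg.
have := crossing_edges_left eC fC ef; have := crossing_edges_left fC gC fg.
have := planar_below P (CA' fC) (w := inl (t e)) isT.
have := planar_above P (CA' fC) (w := inl (h g)) isT; move: ef fg.
have := Cp eC; have := Cp gC; have := planar_tail P (CA' eC).
have := planar_head P (CA' gC).
have := planar_vertex_edge P (t e) (CA' fC); have := planar_vertex_edge P (h g) (CA' fC).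
by rewrite /left_of /below /weakly_below; lia.
Qed.

(* Edges of equal rank pairwise overlap in the x-order, and all of them end above
   [p]; so each of them is nested inside all the edges on one of its sides, or has the
   highest tail or the lowest head of its class. *)
Lemma crossing_edges_pages (rk : E -> nat) :
  (forall e f, precedes e f -> (rk e < rk f)%N) ->
  exists c : E -> nat,
    (forall e, (c e < 4 * (rk e).+1)%N) /\
    forall z, extends x y z ->
      {in C &, forall e f, c e = c f -> ~~ crosses t h z e f}.
Proof.
move=> rkP.
pose left_heads f := [forall e in C, (rk e == rk f) && (x (inr e) < x (inr f)) ==>
  weakly_below x y (inl (h f)) (inl (h e))].
pose left_tails f := [forall e in C, (rk e == rk f) && (x (inr e) < x (inr f)) ==>
  weakly_below x y (inl (t e)) (inl (t f))].
(* Four colours per rank: the two bits record whether [e] is nested, by its head or by its tail,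
   with respect to all edges of its rank on its left. *)
exists (fun e => 4 * rk e + 2 * left_heads e + left_tails e)%N; split=> [e|z zext].
  by case: (left_heads e); case: (left_tails e); lia.
have zle u v : weakly_below x y (inl u) (inl v) -> z u <= z v.
  rewrite (planar_weakly_below P (u := inl u) (v := inl v))//.
  by case/orP=> [/eqP[->]//|/zext/ltW].
have overlap e f : e \in C -> f \in C -> rk e = rk f -> x (inl (t f)) < x (inl (h e)).
  move=> eC fC ef; rewrite ltNge; apply/negP => le.
  by have := rkP e f; rewrite /precedes eC fC le ef ltnn => /(_ isT).
have nested e f : e \in C -> f \in C -> x (inr e) < x (inr f) -> rk e = rk f ->
    left_heads e = left_heads f -> left_tails e = left_tails f ->
    ~~ crosses t h z e f && ~~ crosses t h z f e.
  move=> eC fC ef rkef hh tt.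
  have Hh : z (h f) <= z (h e) \/ z (t f) <= z (t e).
    case fh: (left_heads f).
      move: fh => /forall_inP/(_ e eC); rewrite rkef eqxx ef => /zle; by left.
    move: hh; rewrite fh => /negbT/forall_inPn[g gC]; rewrite negb_imply.
    move=> /andP[/andP[/eqP rkg ge] nw]; right; apply: zle.
    have := crossing_edges_head gC eC ge; have := crossing_edges_tail eC fC ef.
    by have := overlap g f gC fC (etrans rkg rkef); move: nw; case: weakly_below => //=; lia.
  have Ht : z (t e) <= z (t f) \/ z (h e) <= z (h f).
    case ft: (left_tails f).
      move: ft => /forall_inP/(_ e eC); rewrite rkef eqxx ef => /zle; by left.
    move: tt; rewrite ft => /negbT/forall_inPn[g gC]; rewrite negb_imply.
    move=> /andP[/andP[/eqP rkg ge] nw]; right; apply: zle.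
    by have := crossing_edges_middle gC eC fC ge ef; move: nw; case: weakly_below.
  by rewrite /crosses; lia.
move=> e f eC fC cef.
have [rkef [hh tt]] : rk e = rk f /\ left_heads e = left_heads f /\ left_tails e = left_tails f.
  by move: cef; case: (left_heads e); case: (left_tails e);
    case: (left_heads f); case: (left_tails f) => /=; lia.
have := planar_injx P (CA' eC : alive A (inr e)) (CA' fC : alive A (inr f)).
case: (ltgtP (x (inr e)) (x (inr f))) => [ef|fe|xef] H.
- by have /andP[] := nested _ _ eC fC ef rkef hh tt.
- by have /andP[] := nested _ _ fC eC fe (esym rkef) (esym hh) (esym tt).
- by case: (H xef) => ->; rewrite /crosses ltxx.
Qed.

(** These vertices witness the cost of a barrier: a large rank forces many of them. *)
Definition late_tails := [set u | [exists f in C, [exists g in C,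
  (u == t f) && (x (inl (h g)) <= x (inl u))]]].

(** Every edge of the chain except the first contributes its tail, and the x-coordinates of these
    tails increase strictly. *)
Lemma crossing_edges_chain e s : sorted precedes (rcons s e) ->
  (size s <= #|late_tails|)%N.
Proof.
have -> : size s = size (behead (rcons s e)) by rewrite size_behead size_rcons.
case: (rcons s e) => //= a l al.
have ul : uniq (map t l).
  apply: (@sorted_uniq _ (fun u v => x (inl u) < x (inl v))).
  - by move=> v u w; apply: lt_trans.
  - by move=> u; rewrite ltxx.
  rewrite sorted_map; apply: sub_sorted (path_sorted al) => f g /and3P[fC gC fg].
  have := planar_tail P (CA' fC); have := planar_head P (CA' fC).
  by rewrite /relpre /= /below; lia.
rewrite -(size_map t) -(card_uniqP ul); apply/subset_leq_card/fintype.subsetP.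
elim: l a al {ul} => //= f l IH a /andP[/and3P[aC fC af] fl] u.
rewrite inE => /orP[/eqP->|]; last exact: IH fl _.
rewrite inE; apply/existsP; exists f; rewrite fC; apply/existsP; exists a.
by rewrite aC eqxx.
Qed.

Lemma crossing_edges_cost : exists m (c : E -> nat),
  [/\ (m <= #|late_tails|.+1)%N, forall e, e \in C -> (c e < 4 * m)%N &
    forall z, extends x y z ->
      {in C &, forall e f, c e = c f -> ~~ crosses t h z e f}].
Proof.
have [rk [rkP rks]] := strict_order_rank precedes_irr precedes_trans.
have [c [cr cz]] := crossing_edges_pages rkP.
exists (\max_(e in C) (rk e).+1)%N, c; split=> //.
  apply/bigmax_leqP => e eC; have [s [<- /crossing_edges_chain]] := rks e.
  by rewrite ltnS.
move=> e eC; apply: leq_trans (cr e) _; rewrite leq_mul2l /=.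
exact: leq_bigmax_cond.
Qed.

End CrossingEdges.

(** * Refining the order at a gap of a ladder *)

Record refines (V E : finType) (t h : E -> V) (A : {set E})
  (x y : V + E -> int) (A' : {set E}) (x' y' : V + E -> int) (m : nat) (c : E -> nat) : Prop :=
  Refines {
    refines_planar : planar t h A' x' y';
    refines_below : forall u v, below x y u v -> below x' y' u v;
    refines_colors : forall e, e \in A :\: A' -> (c e < 4 * m)%N;
    refines_pages : forall z, extends x y z ->
      {in A :\: A' &, forall e f, c e = c f -> ~~ crosses t h z e f} }.

Lemma refines_dual (V E : finType) (t h : E -> V) A x y A' x' y' m c :
  refines h t A (fun w => - x w) (fun w => - y w) A' x' y' m c ->
  refines t h A x y A' (fun w => - x' w) (fun w => - y' w) m c.
Proof.
case=> pl bl co pa; split=> //.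
- exact: planar_dual.
- move=> u v; have := bl v u; rewrite /below; lia.
move=> z zx e f eA fA cef.
have zx' : extends (fun w => - x w) (fun w => - y w) (fun v => - z v).
  by move=> u v uv; have := zx v u; move: uv; rewrite /below; lia.
by have := pa _ zx' f e fA eA (esym cef); rewrite /crosses; lia.
Qed.

(* The gap between rungs [l] and [l.+2]. The barrier runs from [q] to the tail [p] of
   the upper rung; taking [q] with maximal x-coordinate ensures that the edges crossing
   the barrier end above [p]. *)
Section Gap.
Variables (V E : finType) (t h : E -> V) (A : {set E}) (x y : V + E -> int).
Hypothesis P : planar t h A x y.
Variables (T : nat) (r : nat -> E).
Hypothesis L : ladder t h A x y T r.
Variable l : nat.
Hypothesis lT : (l.+2 < T)%N.

Let p := t (r l.+2).
Let b := h (r l).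
Let b' := h (r l.+2).
Let reachable z := [&& weakly_below x y (inl b) (inl z),
  weakly_below x y (inl z) (inl b') & left_of x y (inl p) (inl z)].

Let l2A : r l.+2 \in A. Proof. exact: (ladder_alive L lT). Qed.

Lemma gap_end : exists2 q : V, reachable q & forall z, reachable z ->
  x (inl z) <= x (inl q).
Proof.
have bZ : reachable b.
  apply/and3P; split; first by rewrite /weakly_below !lexx.
    have /(ladder_heads_below P L) : (l < l.+2 < T)%N by rewrite lT andbT.
    by rewrite /below /weakly_below -/b -/b'; lia.
  by apply: (ladder_tail_left_head P L); rewrite ltnSn.
by case: (Order.TotalTheory.arg_maxP (fun z => x (inl z)) bZ) => q qZ qmax; exists q.
Qed.

Section WithEnd.
Variable q : V.
Hypothesis qZ : reachable q.
Hypothesis qmax : forall z, reachable z -> x (inl z) <= x (inl q).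

Let D := [set d : V | left_of x y (inl p) (inl d) &&
  ((d == q) || left_of x y (inl d) (inl q))].
Let C := [set e in A | [&& left_of x y (inl p) (inr e), left_of x y (inr e) (inl q)
  & below x y (inl p) (inl (h e))]].

(** Suppose the head [z] of [e] is not above [p]. As [z] is not in [D], its x-coordinate exceeds
    that of [q], so by maximality [z] is not weakly below [b']. But then [e] is not below [b']
    either, which contradicts the coordinates. *)
Lemma gap_crossing e : e \in A -> left_of x y (inl p) (inr e) ->
  left_of x y (inr e) (inl q) -> ~~ under x y D (inr e) -> e \in C.
Proof.
move=> eA pe eq neD; rewrite inE eA pe eq /=; set z := h e.
have zD : z \notin D.
  apply: contra neD => zD; apply/existsP; exists z; rewrite zD /=.
  by have := planar_head P eA; rewrite /below /weakly_below -/z; lia.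
have [/andP[pex pey] /andP[eqx eqy]] := (pe, eq).
have /andP[ezx ezy] : below x y (inr e) (inl z) := planar_head P eA.
have [/andP[bqx bqy] /andP[qb'x qb'y] _] := and3P qZ.
rewrite /below; apply/andP; split; first by lia.
rewrite ltNge; apply/negP => zp.
have pz : left_of x y (inl p) (inl z).
  by have := planar_eq P (u := inl z) (v := inl p) isT isT; rewrite /left_of; lia.
have qz : x (inl q) < x (inl z).
  move: zD; rewrite inE pz /= negb_or => /andP[zq].
  have : x (inl z) != x (inl q).
    apply: contra zq => /eqP.
    by move/(@planar_injx _ _ _ _ _ _ _ P (inl z) (inl q) isT isT) => [->].
  by rewrite /left_of; lia.
have zb' : ~~ weakly_below x y (inl z) (inl b').
  apply/negP => zb'; have := qmax (z := z); rewrite /reachable zb' pz /weakly_below.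
  by lia.
have pb' : y (inl p) < y (inl b').
  by have := planar_head P l2A; have := planar_tail P l2A; rewrite /below -/p -/b'; lia.
have eb' : y (inl b') < y (inr e).
  have := planar_above P eA (w := inl b') isT; rewrite (negbTE zb') /below.
  by have := planar_vertex_edge P b' eA; lia.
by move: pz; rewrite /left_of; lia.
Qed.

(** Once the edges in [C] are removed, everything alive between [p] and [D] is under [D], as the
    barrier requires. Since [b] is weakly below [q], the barrier puts it below [p]. *)
Lemma gap_end_refines : exists A' x' m c,
  [/\ refines t h A x y A' x' y m c, below x' y (inl b) (inl p) &
      (m <= #|late_tails t h C x|.+1)%N].
Proof.
have CA : C \subset A by apply/fintype.subsetP => e; rewrite inE => /andP[].
have Cp e : e \in C -> left_of x y (inl p) (inr e) && below x y (inl p) (inl (h e)).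
  by rewrite inE => /and4P[_ -> _ ->].
have [m [c [mS cm cz]]] := crossing_edges_cost P CA Cp.
have AD : A :\: (A :\: C) = C.
  by rewrite finset.setDDr finset.setDv finset.set0U; apply/finset.setIidPr.
have pD d : d \in D -> left_of x y (inl p) (inl d) by rewrite inE => /andP[].
have cvx w d : alive (A :\: C) w -> d \in D -> left_of x y (inl p) w ->
    left_of x y w (inl d) -> under x y D w.
  case: w => [v|e] /= eC dD pw wd.
    apply/existsP; exists v; rewrite inE pw /weakly_below !lexx /= andbT.
    move: dD; rewrite inE => /andP[_ /orP[/eqP <-|dq]]; apply/orP; right=> //.
    exact: left_of_trans wd dq.
  move: eC; rewrite inE => /andP[eC eA]; apply: contraNT eC; apply: gap_crossing => //.
  move: dD; rewrite inE => /andP[_ /orP[/eqP <-//|dq]].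
  exact: left_of_trans wd dq.
exists (A :\: C), (shifted x y p D), m, c; split=> //.
- split=> //.
  + exact: (barrier_planar P pD (finset.subsetDl A C) cvx).
  + by move=> u v; exact: shifted_below.
  + by move=> e; rewrite AD; apply: cm.
  + by rewrite AD.
- apply: (shifted_new pD); last by rewrite /weakly_below !lexx.
  apply/existsP; exists q; rewrite inE eqxx /=; move: qZ; rewrite /reachable.
  by move=> /and3P[-> _ ->].
Qed.

(** The edge [g] whose head precedes [s] lies beyond the upper rung in the x-order, which puts [s]
    to the right of that rung. If [s] were also to the right of [r l], then [r l] would be below the
    edge starting at [s], hence weakly below [s]. *)
Lemma gap_late_tails s : s \in late_tails t h C x ->
  [/\ weakly_below x y (inl s) (inl b'),
      forall j, (l.+2 <= j < T)%N -> left_of x y (inr (r j)) (inl s) &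
      ~~ left_of x y (inr (r l)) (inl s)].
Proof.
rewrite inE => /existsP[f /andP[fC /existsP[g /and3P[gC /eqP -> gf]]]].
have [/andP[bqx bqy] /andP[qb'x qb'y] _] := and3P qZ.
move: fC gC; rewrite !inE => /and4P[fA /andP[pfx pfy] /andP[fqx fqy] _].
move=> /and4P[gA /andP[pgx pgy] _ /andP[phx phy]].
have [/andP[ufx ufy] /andP[ghx ghy]] := (planar_tail P fA, planar_head P gA).
have /andP[pmx pmy] : below x y (inl p) (inr (r l.+2)) := planar_tail P l2A.
have /andP[mbx mby] : below x y (inr (r l.+2)) (inl b') := planar_head P l2A.
have mg : x (inr (r l.+2)) < x (inr g).
  rewrite ltNge le_eqVlt; apply/negP => /orP[|gm].
    by rewrite (planar_eq P (u := inr g) (v := inr (r l.+2)))//; lia.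
  have gmy : y (inr g) < y (inr (r l.+2)) by lia.
  have := planar_below P l2A (w := inr g) gA; rewrite /below gm gmy => /(_ isT).
  by rewrite /weakly_below -/p; lia.
have l2s : left_of x y (inr (r l.+2)) (inl (t f)) by rewrite /left_of; lia.
split=> //.
- by move: l2s; rewrite /left_of /weakly_below; lia.
- move=> j /andP[]; rewrite leq_eqVlt => /orP[/eqP<-//|lj jT].
  by apply: left_of_trans l2s; apply: (ladder_left L); rewrite lj.
have lA : r l \in A by apply: (ladder_alive L); lia.
have /andP[_ lb] : below x y (inr (r l)) (inl b) := planar_head P lA.
apply/negP => /andP[lsx lsy].
have := planar_below P fA (w := inr (r l)) lA.
have -> : below x y (inr (r l)) (inr f) by rewrite /below; lia.
by rewrite /weakly_below => /(_ isT); lia.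
Qed.

End WithEnd.

Lemma gap_refines : exists A' x' y' m c (S : {set V}),
  [/\ refines t h A x y A' x' y' m c, below x' y' (inl b) (inl p),
      (0 < #|S|)%N, (m <= 2 * #|S|)%N &
      forall s, s \in S ->
      [/\ weakly_below x y (inl s) (inl b'),
          forall j, (l.+2 <= j < T)%N -> left_of x y (inr (r j)) (inl s) &
          ~~ left_of x y (inr (r l)) (inl s)]].
Proof.
have [q qZ qmax] := gap_end; have [A' [x' [m [c [rf bp mS]]]]] := gap_end_refines qZ qmax.
set S := late_tails _ _ _ _ in mS.
(* Adding [b] makes the set of witnesses nonempty, so that the extra 1 in [mS] is absorbed by a
   factor 2. *)
have S0 : (0 < #|b |: S|)%N by apply/card_gt0P; exists b; rewrite !inE eqxx.
have SbS : (#|S| <= #|b |: S|)%N by apply/subset_leq_card/finset.subsetUr.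
exists A', x', y, m, c, (b |: S); split=> //; first by lia.
move=> s; rewrite finset.in_setU1 => /orP[/eqP->|]; last exact: (gap_late_tails qZ).
have /(ladder_heads_below P L) bb' : (l < l.+2 < T)%N by rewrite lT andbT.
have lA : r l \in A by apply: (ladder_alive L); lia.
split; first by move: bb'; rewrite /below /weakly_below -/b -/b'; lia.
  by move=> j /andP[lj jT]; apply: (ladder_head_right P L); rewrite jT andbT; lia.
by have := planar_head P lA; rewrite /below /left_of -/b; lia.
Qed.

End Gap.

(** * Combining the gaps of a ladder *)

Lemma card_bigcup_disjoint (V : finType) (F : nat -> {set V}) n :
  (forall i j, (i < j < n)%N -> [disjoint F i & F j]) ->
  #|\bigcup_(i < n) F i| = (\sum_(i < n) #|F i|)%N.
Proof.
elim: n => [|n IH] dF; first by rewrite !big_ord0 finset.cards0.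
rewrite !big_ord_recr /= -IH => [|i j ij]; last by apply: dF; lia.
rewrite finset.cardsU [X in (_ - X)%N](_ : _ = 0)%N ?subn0//; apply/eqP.
rewrite finset.cards_eq0 finset.setI_eq0 disjoint_sym; apply: finset.bigcup_disjoint => i _.
by rewrite disjoint_sym; apply: dF; rewrite ltn_ord ltnSn.
Qed.

Lemma leq_sum_window (F : nat -> nat) a b n c : (a + b <= n)%N ->
  (forall i, (a <= i < a + b)%N -> (c <= F i)%N) -> (b * c <= \sum_(i < n) F i)%N.
Proof.
move=> abn cF; rewrite -(big_mkord xpredT) (@big_cat_nat _ _ _ a) //=; last by lia.
rewrite (@big_cat_nat _ _ _ (a + b) a) ?leq_addr//= addnCA; apply: leq_trans (leq_addr _ _).
rewrite -[X in (X * _)%N](addKn a) -sum_nat_const_nat.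
by rewrite big_nat [X in (_ <= X)%N]big_nat; apply: leq_sum.
Qed.

Section LadderGaps.
Variables (V E : finType) (t h : E -> V) (A : {set E}) (x y : V + E -> int).
Hypothesis P : planar t h A x y.
Variables (T : nat) (r : nat -> E).
Hypothesis L : ladder t h A x y T r.

(** The two conditions on rungs tie [S] to its gap: witnesses of different even gaps are
    disjoint. *)
Definition gap_lower l (S : {set V}) := forall s, s \in S ->
  [/\ weakly_below x y (inl s) (inl (h (r l.+2))),
      forall j, (l.+2 <= j < T)%N -> left_of x y (inr (r j)) (inl s) &
      ~~ left_of x y (inr (r l)) (inl s)].

Definition gap_upper l (S : {set V}) := forall s, s \in S ->
  [/\ weakly_below x y (inl (t (r l))) (inl s),
      forall j, (j <= l)%N -> left_of x y (inl s) (inr (r j)) &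
      ~~ left_of x y (inl s) (inr (r l.+2))].

Definition gap_cost l (m : nat) := exists A' x' y' c,
  refines t h A x y A' x' y' m c /\ below x' y' (inl (h (r l))) (inl (t (r l.+2))).

(** The gap admits one barrier and, after a half-turn, a second one. Choosing the one with fewer
    witnesses bounds the cost by both sets. *)
Lemma gap_refines_both l : (l.+2 < T)%N -> exists mS : nat * ({set V} * {set V}),
  [/\ gap_cost l mS.1, (0 < #|mS.2.1|)%N /\ (0 < #|mS.2.2|)%N,
      (mS.1 <= 2 * minn #|mS.2.1| #|mS.2.2|)%N, gap_lower l mS.2.1 &
      gap_upper l mS.2.2].
Proof.
move=> lT; have [A1 [x1 [y1 [m1 [c1 [S1 [rf1 b1 S10 mS1 lo]]]]]]] := gap_refines P L lT.
(* The reversed ladder lists this gap at index [T - l.+3]. *)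
have l'T : ((T - l.+3).+2 < T)%N by lia.
have [A2 [x2 [y2 [m2 [c2 [S2 [rf2 b2 S20 mS2 up]]]]]]] :=
  gap_refines (planar_dual P) (ladder_dual L) l'T.
have e1 : (T - (T - l.+3).+1)%N = l.+2 by lia.
have e2 : (T - (T - l.+3).+3)%N = l by lia.
rewrite e1 e2 in b2 up.
have {}up : gap_upper l S2.
  move=> s /up[s1 s2 s3]; split.
  - by move: s1; rewrite /weakly_below; lia.
  - move=> j jl; have := s2 (T - j.+1)%N; rewrite (_ : T - (T - j.+1).+1 = j)%N; last by lia.
    by rewrite /left_of; lia.
  - by move: s3; rewrite /left_of; lia.
have [le|le] := leqP #|S1| #|S2|.
  exists (m1, (S1, S2)); split=> //=; last by rewrite (minn_idPl le).
  by exists A1, x1, y1, c1.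
exists (m2, (S1, S2)); split=> //=; last by rewrite (minn_idPr (ltnW le)).
exists A2, (fun w => - x2 w), (fun w => - y2 w), c2; split.
  exact: refines_dual.
by move: b2; rewrite /below; lia.
Qed.

End LadderGaps.

Definition comparable_pairs (V E : finType) (x y : V + E -> int) : {set V * V} :=
  [set uv | below x y (inl uv.1) (inl uv.2)].

(* Take a gap of least cost in the middle third: on one side of it, at least [k] gaps
   cost no less, and on the other side there are at least [2 * k] gaps. The vertices
   witnessing the costs on both sides become comparable across the barrier. *)
Lemma ladder_refines (V E : finType) (t h : E -> V) (A : {set E}) (x y : V + E -> int)
    (k : nat) (r : nat -> E) : planar t h A x y -> (0 < k)%N ->
  ladder t h A x y (12 * k).+1 r ->
  exists A' x' y' m c, [/\ refines t h A x y A' x' y' m c,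
    (#|comparable_pairs x y| < #|comparable_pairs x' y'|)%N &
    (#|comparable_pairs x y| + k ^ 2 * m <= #|comparable_pairs x' y'|)%N].
Proof.
move=> P k0 L; set T := (12 * k).+1 in L.
(* Only the gaps starting at even rungs are used, and [12 * k + 1] rungs contain [6 * k] of them.
   Beyond that the values are dummies. *)
have /choice[mS mSP] : forall i : nat, exists mS : nat * ({set V} * {set V}),
    (i < 6 * k)%N ->
    [/\ gap_cost t h A x y r (2 * i) mS.1, (0 < #|mS.2.1|)%N /\ (0 < #|mS.2.2|)%N,
      (mS.1 <= 2 * minn #|mS.2.1| #|mS.2.2|)%N, gap_lower h x y T r (2 * i) mS.2.1 &
      gap_upper t x y r (2 * i) mS.2.2].
  move=> i; have [ik|] := ltnP i (6 * k)%N; last by exists (0, (finset.set0, finset.set0))%N.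
  have [|mS mSP] := @gap_refines_both _ _ _ _ _ _ _ P T r L (2 * i)%N; first by lia.
  by exists mS.
pose S i := (mS i).2.1; pose S' i := (mS i).2.2.
pose mu i := minn #|S i| #|S' i|.
have [i0 i0k mu0] : exists2 i0, (2 * k <= i0 < 4 * k)%N &
    forall i, (2 * k <= i < 4 * k)%N -> (mu i0 <= mu i)%N.
  have k4 : (2 * k < 4 * k)%N by lia.
  have /= := @arg_minnP _ (Ordinal k4) (fun i : 'I__ => 2 * k <= i)%N
    (fun i : 'I__ => mu i) (leqnn _).
  case=> i0 ki0 i0min; exists i0; first by rewrite ki0 ltn_ord.
  by move=> i /andP[ki i4]; apply: (i0min (Ordinal i4)).
have [|[A' [x' [y' [c [rf b0]]]]] _ mmu _ _] := mSP i0; first by lia.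
have S_gt0 i : (i < 6 * k)%N -> (0 < #|S i|)%N by case/mSP => _ [].
have S'_gt0 i : (i < 6 * k)%N -> (0 < #|S' i|)%N by case/mSP => _ [].
have loS i : (i < 6 * k)%N -> gap_lower h x y T r (2 * i) (S i) by case/mSP.
have upS i : (i < 6 * k)%N -> gap_upper t x y r (2 * i) (S' i) by case/mSP.
pose U := \bigcup_(i < i0) S i.
pose U' := \bigcup_(i < 6 * k - i0.+1) S' (i0.+1 + i)%N.
have cU : #|U| = (\sum_(i < i0) #|S i|)%N.
  apply: card_bigcup_disjoint => i j ij; rewrite -finset.setI_eq0; apply/finset.set0Pn => -[s].
  rewrite inE => /andP[/loS si /loS sj].
  have [|_ /(_ (2 * j)%N) + _] := si; first by lia.
  have [|_ _ /negP nj] := sj; first by lia.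
  by move=> /(_ _)/nj; apply; lia.
have cU' : #|U'| = (\sum_(i < 6 * k - i0.+1) #|S' (i0.+1 + i)%N|)%N.
  apply: (@card_bigcup_disjoint _ (fun i => S' (i0.+1 + i)%N)) => i j ij.
  rewrite -finset.setI_eq0; apply/finset.set0Pn => -[s].
  rewrite inE => /andP[/upS si /upS sj].
  have [|_ /(_ (2 * (i0.+1 + i)).+2) + _] := sj; first by lia.
  have [|_ _ /negP nj] := si; first by lia.
  by move=> /(_ _)/nj; apply; lia.
(* On the side of [i0] with at least [k] further gaps of the middle third, each has at least [mu i0]
   witnesses. On the other side there are at least [2 * k] gaps, each with at least one witness. *)
have gain : (2 * k ^ 2 * mu i0 <= #|U| * #|U'|)%N.
  rewrite cU cU'; have [i0lo|i0hi] := leqP (3 * k) i0.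
    have H1 : (k * mu i0 <= \sum_(i < i0) #|S i|)%N.
      apply: (@leq_sum_window (fun i => #|S i|) (2 * k)) => [|i ik]; first by lia.
      by apply: leq_trans (mu0 i _) _; [lia|rewrite geq_minl].
    have H2 : (2 * k * 1 <= \sum_(i < 6 * k - i0.+1) #|S' (i0.+1 + i)%N|)%N.
      apply: (@leq_sum_window (fun i => #|S' (i0.+1 + i)%N|) 0) => [|i ik]; first by lia.
      by apply: S'_gt0; lia.
    by apply: leq_trans (leq_mul H1 H2); nia.
  have H1 : (2 * k * 1 <= \sum_(i < i0) #|S i|)%N.
    apply: (@leq_sum_window (fun i => #|S i|) 0) => [|i ik]; first by lia.
    by apply: S_gt0; lia.
  have H2 : (k * mu i0 <= \sum_(i < 6 * k - i0.+1) #|S' (i0.+1 + i)%N|)%N.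
    apply: (@leq_sum_window (fun i => #|S' (i0.+1 + i)%N|) 0) => [|i ik]; first by lia.
    by apply: leq_trans (mu0 (i0.+1 + i)%N _) _; [lia|rewrite geq_minr].
  by apply: leq_trans (leq_mul H1 H2); nia.
(* From [u] in [U] one climbs to the head of rung [2 * i0], across the barrier to the tail of rung
   [2 * i0 + 2], and on to [v] in [U']. *)
have new : (#|comparable_pairs x y| + #|U| * #|U'| <= #|comparable_pairs x' y'|)%N.
  have wb u v : weakly_below x y (inl u) (inl v) -> weakly_below x' y' (inl u) (inl v).
    rewrite (planar_weakly_below P (u := inl u) (v := inl v))// => /orP[/eqP->|].
      by rewrite /weakly_below !lexx.
    by move=> /(refines_below rf); rewrite /below /weakly_below; lia.
  rewrite -finset.cardsX -finset.cardsUI [X in (_ + X)%N](_ : _ = 0)%N ?addn0.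
    apply/subset_leq_card/fintype.subsetP => -[u v]; rewrite !inE /=.
    case/orP=> [/(refines_below rf)//|].
    move=> /andP[/finset.bigcupP[i _ /loS si] /finset.bigcupP[j _ /upS sj]].
    have [|/wb ub _ _] := si; first by have := ltn_ord i; lia.
    have [|/wb pv _ _] := sj; first by have := ltn_ord j; lia.
    have bb : weakly_below x' y' (inl (h (r (2 * i).+2))) (inl (h (r (2 * i0)%N))).
      apply: wb; have [e|ne] := eqVneq (2 * i).+2 (2 * i0)%N.
        by rewrite e /weakly_below !lexx.
      have /(ladder_heads_below P L) : ((2 * i).+2 < 2 * i0 < T)%N.
        by have := ltn_ord i; lia.
      by rewrite /below /weakly_below; lia.
    have pp : weakly_below x' y' (inl (t (r (2 * i0).+2))) (inl (t (r (2 * (i0.+1 + j))%N))).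
      apply: wb; have [e|ne] := eqVneq (2 * i0).+2 (2 * (i0.+1 + j))%N.
        by rewrite e /weakly_below !lexx.
      have /(ladder_tails_below P L) : ((2 * i0).+2 < 2 * (i0.+1 + j) < T)%N.
        by have := ltn_ord j; lia.
      by rewrite /below /weakly_below; lia.
    by move: ub bb b0 pp pv; rewrite /below /weakly_below; lia.
  (* These pairs are new: before the refinement, [v] is left of rung [2 * i0], which is left of
     [u]. *)
  apply/eqP; rewrite finset.cards_eq0; apply/eqP/setP => -[u v]; rewrite !inE /=.
  apply/negP => /and3P[uv /finset.bigcupP[i _ /loS si] /finset.bigcupP[j _ /upS sj]].
  have [|_ /(_ (2 * i0)%N) + _] := si; first by have := ltn_ord i; lia.
  have [|_ /(_ (2 * i0)%N) + _] := sj; first by have := ltn_ord j; lia.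
  have -> : (2 * i0 <= 2 * (i0.+1 + j))%N by lia.
  have -> : ((2 * i).+2 <= 2 * i0 < T)%N by have := ltn_ord i; lia.
  by move=> /(_ isT) + /(_ isT); move: uv; rewrite /below /left_of; lia.
have mu_gt0 : (0 < mu i0)%N by rewrite leq_min S_gt0 ?S'_gt0//; lia.
rewrite -/(mu i0) in mmu.
exists A', x', y', (mS i0).1, c; split=> //.
  by apply: leq_trans new; rewrite -[X in (X < _)%N]addn0 ltn_add2l; nia.
by apply: leq_trans new; rewrite leq_add2l; apply: leq_trans gain; nia.
Qed.

(** The level is the position of the highest bit in which [a] and [b] differ. *)
Lemma dyadic_level a b L : (a < b < 2 ^ L)%N -> exists k,
  [/\ (k < L)%N, (a %/ 2 ^ k.+1 = b %/ 2 ^ k.+1)%N & (a %/ 2 ^ k < b %/ 2 ^ k)%N].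
Proof.
move=> /andP[ab bL]; have : (a %/ 2 ^ L = b %/ 2 ^ L)%N.
  by rewrite !divn_small ?(ltn_trans ab).
elim: L {bL} => [|L IH]; first by rewrite !divn1; lia.
have [/IH[k [kL ? ?]] _|ne eL] := eqVneq (a %/ 2 ^ L)%N (b %/ 2 ^ L)%N.
  by exists k; split=> //; lia.
by exists L; split=> //; rewrite ltn_neqAle ne leq_div2r// ltnW.
Qed.

(** * Pages of an order without large ladders *)

Section NoLadder.
Variables (V E : finType) (t h : E -> V) (A : {set E}) (x y : V + E -> int).
Hypothesis P : planar t h A x y.
Variables T L : nat.
Hypothesis no_ladder : forall r, ~ ladder t h A x y T r.
Hypothesis VL : (#|V| <= 2 ^ L)%N.

Let pos v := #|[set u | x (inl u) < x (inl v)]|.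

Let pos_lt u v : (pos u < pos v)%N = (x (inl u) < x (inl v)).
Proof.
have le a b : x (inl a) <= x (inl b) -> (pos a <= pos b)%N.
  by move=> ab; apply/subset_leq_card/fintype.subsetP => w; rewrite !inE => /lt_le_trans; apply.
apply/idP/idP => [|uv]; first by rewrite ltnNge ltNge; apply: contra => /le.
apply/proper_card/properP; split; last by exists u; rewrite inE ?ltxx.
by apply/fintype.subsetP => w; rewrite !inE => /lt_trans; apply.
Qed.

Let pos_bound v : (pos v < 2 ^ L)%N.
Proof.
apply: leq_trans VL; rewrite -finset.cardsT; apply/proper_card/properP; split.
  exact: finset.subsetT.
by exists v; rewrite inE ?ltxx.
Qed.

Let th e : e \in A -> x (inl (t e)) < x (inl (h e)).
Proof.
by move=> eA; have := planar_tail P eA; have := planar_head P eA; rewrite /below; lia.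
Qed.

Section Level.
Variable lev : E -> nat.
Hypothesis levP : forall e, e \in A -> [/\ (lev e < L)%N,
  (pos (t e) %/ 2 ^ (lev e).+1 = pos (h e) %/ 2 ^ (lev e).+1)%N &
  (pos (t e) %/ 2 ^ lev e < pos (h e) %/ 2 ^ lev e)%N].

(** Such edges share a block of [2 ^ (lev e).+1] positions; their tails lie in its first half and
    their heads in its second half. *)
Let same e f := [&& e \in A, f \in A, lev e == lev f &
  (pos (t e) %/ 2 ^ (lev e).+1 == pos (t f) %/ 2 ^ (lev e).+1)%N].

Let same_sym e f : same e f = same f e.
Proof.
by rewrite /same; case: eqVneq => [->|]; rewrite ?andbF// andbCA eq_sym.
Qed.

Let same_trans : transitive same.
Proof.
move=> f e g /and4P[eA fA /eqP lef /eqP ef] /and4P[_ gA /eqP lfg /eqP fg].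
by rewrite /same eA gA ef lef lfg eqxx -lfg fg eqxx.
Qed.

Let same_mid e f : same e f -> x (inl (t e)) < x (inl (h f)).
Proof.
move=> /and4P[eA fA /eqP lef /eqP].
have [_ eb em] := levP eA; have [_ fb fm] := levP fA.
rewrite -lef in fb fm; rewrite -pos_lt => ef; rewrite ltnNge; apply/negP.
move=> /(leq_div2r (2 ^ lev e)) he; move: eb fb ef em fm he.
by rewrite !expnSr !divnMA; lia.
Qed.

Let crosses_same e f : e \in A -> f \in A -> lev e = lev f ->
  crosses t h (fun v => x (inl v)) e f -> same e f.
Proof.
move=> eA fA lef /and3P[]; rewrite -!pos_lt => te fe _.
rewrite /same eA fA lef eqxx /= eqn_leq -lef.
have [_ -> _] := levP eA; rewrite [X in _ && X]leq_div2r ?andbT ?(ltnW fe)//.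
by have [_ <- _] := levP eA; rewrite leq_div2r// ltnW.
Qed.

Let ordered e f := [&& same e f, x (inl (t e)) < x (inl (t f)) &
  x (inl (h e)) < x (inl (h f))].

Let dec e f := ordered e f && left_of x y (inr f) (inr e).
Let inc e f := ordered e f && left_of x y (inr e) (inr f).

Let ordered_trans : transitive ordered.
Proof.
move=> f e g /and3P[ef tef hef] /and3P[fg tfg hfg].
by rewrite /ordered (same_trans ef fg) (lt_trans tef tfg) (lt_trans hef hfg).
Qed.

Let dec_trans : transitive dec.
Proof.
move=> f e g /andP[ef ef'] /andP[fg fg']; rewrite /dec (ordered_trans ef fg).
exact: left_of_trans fg' ef'.
Qed.

Let crosses_ordered e f : same e f -> crosses t h (fun v => x (inl v)) e f ->
  dec e f || inc e f.
Proof.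
move=> ef /and3P[te fe hf]; rewrite /dec /inc /ordered ef te hf /=.
have /and4P[eA fA _ _] := ef.
have /andP[hex hey] := planar_head P eA; have /andP[hfx hfy] := planar_head P fA.
have : inr e != inr f :> V + E by apply: contraTneq te => -[->]; rewrite ltxx.
have := planar_eq P (u := inr e) (v := inr f) eA fA => xy ne.
have {}ne : x (inr e) != x (inr f).
  by apply: contra ne => /eqP /(planar_injx P (eA : alive A (inr e)) (fA : alive A (inr f)))->.
have := planar_above P fA (w := inr e) eA; have := planar_above P eA (w := inr f) fA.
have := planar_below P fA (w := inl (h e)) isT.
have := planar_vertex_edge P (h e) fA.
by rewrite /below /weakly_below /left_of; lia.
Qed.

(** The tail of [g] precedes the head of [e] in the x-order. If [f] precedes that head, it is below
    it, and so is the head of [f]; otherwise the tail of [g] is below [f], hence weakly below the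
    tail of [f]. Both contradict the order of the endpoints. *)
Let no_inc_triple e f g : inc e f -> ~~ inc f g.
Proof.
move=> /andP[ef /andP[efx efy]]; apply/negP => /andP[fg /andP[fgx fgy]].
have /and3P[sef tef hef] := ef; have /and3P[sfg tfg hfg] := fg.
have /same_mid ge : same g e by rewrite same_sym; apply: same_trans sef sfg.
have /and4P[eA fA _ _] := sef; have /and4P[_ gA _ _] := sfg.
have := planar_tail P gA; have := planar_head P eA.
have := planar_above P fA (w := inl (h e)) isT.
have := planar_below P fA (w := inl (t g)) isT.
have := planar_vertex_edge P (h e) fA; have := planar_vertex_edge P (t g) fA.
by rewrite /below /weakly_below; lia.
Qed.

Let ladder_of_chain e s : e \in A -> sorted dec (rcons s e) -> (size s < T)%N.
Proof.
move=> eA es; rewrite ltnNge; apply/negP => Ts.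
apply: (@no_ladder (nth e (rcons s e))).
have nthP i j : (i < j < T)%N -> dec (nth e (rcons s e) i) (nth e (rcons s e) j).
  by move=> ij; apply: (sorted_ltn_nth dec_trans) => //; rewrite ?inE ?size_rcons; lia.
have alv i : (i < T)%N -> nth e (rcons s e) i \in A.
  move=> iT; have : dec (nth e (rcons s e) i) (nth e (rcons s e) (size s)).
    by apply: (sorted_ltn_nth dec_trans) => //; rewrite ?inE ?size_rcons; lia.
  by case/andP => /and3P[/and4P[]].
split=> //.
- by move=> i j /nthP/andP[/and3P[]].
- by move=> i j /nthP/andP[/and3P[]].
- by move=> i j /nthP/andP[].
Qed.

Lemma level_pages : exists c : E -> nat,
  (forall e, e \in A -> (c e < 2 * T * L)%N) /\
  {in A &, forall e f, c e = c f -> ~~ crosses t h (fun v => x (inl v)) e f}.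
Proof.
have irr : irreflexive dec by move=> e; rewrite /dec /left_of ltxx andbF.
have [rk [rkP rks]] := strict_order_rank irr dec_trans.
have rkT e : e \in A -> (rk e < T)%N.
  by move=> eA; have [s [<- es]] := rks e; apply: ladder_of_chain es.
(* Level and rank exclude crossings of type [dec]. If [inc e f] held with equal colours, [e] would
   be late like [f], giving an increasing triple. *)
pose late f := [exists e, inc e f && (rk e == rk f)].
exists (fun e => (lev e * T + rk e) * 2 + late e)%N; split.
  move=> e eA; have := rkT e eA; have [lL _ _] := levP eA.
  by case: (late e) => /=; nia.
move=> e f eA fA cef; apply/negP => ef.
have [l_ef late_ef] : (lev e * T + rk e = lev f * T + rk f)%N /\ late e = late f.
  by move: cef; case: (late e); case: (late f) => /=; lia.
have T0 : (0 < T)%N by apply: leq_ltn_trans (rkT e eA).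
have lef : lev e = lev f.
  have := congr1 (fun n => n %/ T)%N l_ef.
  by rewrite !divnMDl// !divn_small ?rkT// !addn0.
have rkef : rk e = rk f by move: l_ef; rewrite lef => /addnI.
case/orP: (crosses_ordered (crosses_same eA fA lef ef) ef) => [/rkP|i].
  by rewrite rkef ltnn.
have lf : late f by apply/existsP; exists e; rewrite i rkef eqxx.
move: late_ef; rewrite lf => /existsP[g /andP[ge _]].
by have := no_inc_triple f ge; rewrite i.
Qed.

End Level.

Lemma no_ladder_pages : exists c : E -> nat,
  (forall e, e \in A -> (c e < 2 * T * L)%N) /\
  {in A &, forall e f, c e = c f -> ~~ crosses t h (fun v => x (inl v)) e f}.
Proof.
have /choice[lev levP] : forall e, exists k, e \in A -> [/\ (k < L)%N,
    (pos (t e) %/ 2 ^ k.+1 = pos (h e) %/ 2 ^ k.+1)%N &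
    (pos (t e) %/ 2 ^ k < pos (h e) %/ 2 ^ k)%N].
  move=> e; have [eA|] := boolP (e \in A); last by exists 0%N.
  have [|k kP] := @dyadic_level (pos (t e)) (pos (h e)) L; last by exists k.
  by rewrite pos_lt th ?pos_bound.
exact: level_pages levP.
Qed.

End NoLadder.

(** * Iterating the refinement *)

Theorem planar_pages (V E : finType) (t h : E -> V) (A : {set E}) (x y : V + E -> int)
    (k L : nat) : (0 < k)%N -> (#|V| <= 2 ^ L)%N -> planar t h A x y ->
  exists (z : V -> int) (c : E -> nat) (K : nat),
    [/\ injective z, extends x y z, (k ^ 2 * K <= #|V| ^ 2)%N,
      forall e, e \in A -> (c e < 2 * (12 * k).+1 * L + 4 * K)%N &
      {in A &, forall e f, c e = c f -> ~~ crosses t h z e f}].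
Proof.
(* Induction on the number of pairs not yet comparable. The third clause is a potential: a
   refinement of cost [m] adds at least [k ^ 2 * m] comparable pairs. *)
move=> k0 VL; suff : forall N (A : {set E}) (x y : V + E -> int),
    (#|V| ^ 2 - #|comparable_pairs x y| < N)%N ->
    planar t h A x y -> exists (z : V -> int) (c : E -> nat) (K : nat),
    [/\ injective z, extends x y z,
      (k ^ 2 * K + #|comparable_pairs x y| <= #|V| ^ 2)%N,
      forall e, e \in A -> (c e < 2 * (12 * k).+1 * L + 4 * K)%N &
      {in A &, forall e f, c e = c f -> ~~ crosses t h z e f}].
  move=> main P; have [z [c [K [iz ez K2 cK cz]]]] := main _ _ _ _ (ltnSn _) P.
  by exists z, c, K; split=> //; apply: leq_trans K2; apply: leq_addr.
have cpV (x1 y1 : V + E -> int) : (#|comparable_pairs x1 y1| <= #|V| ^ 2)%N.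
  by rewrite -mulnn -card_prod max_card.
elim=> // N IH {}A {}x {}y cN P.
have [[r lr]|nl] := pselect (exists r, ladder t h A x y (12 * k).+1 r); last first.
  have nl' r : ~ ladder t h A x y (12 * k).+1 r by move=> lr; apply: nl; exists r.
  have [c [cT cz]] := no_ladder_pages P nl' VL.
  exists (fun v => x (inl v)), c, 0%N; split=> //.
  - by move=> u v /(@planar_injx _ _ _ _ _ _ _ P (inl u) (inl v) isT isT) [].
  - by move=> u v /andP[].
  - by rewrite muln0 add0n.
  - by move=> e /cT; rewrite muln0 addn0.
have [A' [x' [y' [m [c' [rf lt' le']]]]]] := ladder_refines P k0 lr.
have [|z [c [K [iz ez K2 cK cz]]]] := IH A' x' y' _ (refines_planar rf).
  by have := cpV x' y'; lia.
have ezx : extends x y z by move=> u v /(refines_below rf) /ez.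
(* Edges paid for in this round get fresh colours starting at [B]. They stay valid because [z] also
   extends the order before the barrier. *)
pose B := (2 * (12 * k).+1 * L + 4 * K)%N.
exists z, (fun e => if e \in A' then c e else (B + c' e)%N), (K + m)%N; split=> //.
- by apply: leq_trans K2; rewrite mulnDr; lia.
- move=> e eA; case: ifPn => eA'; first by have := cK e eA'; lia.
  have := refines_colors rf (e := e); rewrite inE eA eA' => /(_ isT).
  by rewrite /B; lia.
move=> e f eA fA; case: ifPn => eA'; case: ifPn => fA'.
- exact: cz.
- by have := cK e eA'; rewrite /B; lia.
- by have := cK f fA'; rewrite /B; lia.
move=> /addnI; apply: (refines_pages rf ezx); rewrite inE ?eA' ?fA' //.
Qed.

(** * From drawings to planar orders *)

Lemma strict_total_order_rank (W : finType) (r : rel W) :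
  irreflexive r -> transitive r -> (forall u v, u != v -> r u v || r v u) ->
  exists2 rk : W -> int, injective rk & forall u v, (rk u < rk v) = r u v.
Proof.
move=> irr tr tot; pose rk u : int := #|[set w | r w u]|%:Z.
have mono u v : r u v -> rk u < rk v.
  move=> uv; rewrite ltz_nat; apply/proper_card/properP; split.
    by apply/fintype.subsetP => w; rewrite !inE => /tr; apply.
  by exists u; rewrite inE ?irr.
exists rk => [u v uv|u v].
  have [//|/tot/orP[]/mono] := eqVneq u v; first by rewrite uv ltxx.
  by rewrite uv ltxx.
apply/idP/idP => [uv|/mono//].
have [e|/tot/orP[//|/mono]] := eqVneq u v; first by move: uv; rewrite e ltxx.
by move=> vu; move: (lt_trans uv vu); rewrite ltxx.
Qed.

(** Dushnik and Miller: the union of [lt] with [lf] and the union of [lt] with the reverse of [lf]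
    are linear orders, and [lt] is their intersection. *)
Lemma conjugate_coordinates (W : finType) (lt lf : rel W) :
  irreflexive lt -> irreflexive lf -> transitive lt -> transitive lf ->
  (forall u v, lt u v -> ~~ lf u v /\ ~~ lf v u) ->
  (forall u v, u != v -> [|| lt u v, lt v u, lf u v | lf v u]) ->
  exists x y : W -> int, [/\ injective x, injective y &
    forall u v, (x u < x v) && (y u < y v) = lt u v].
Proof.
move=> lti lfi ltT lfT ex tot.
have asym (r : rel W) : irreflexive r -> transitive r -> forall u v, r u v -> ~~ r v u.
  by move=> ri rT u v uv; apply/negP => /(rT _ _ _ uv); rewrite ri.
pose l1 u v := lt u v || lf u v; pose l2 u v := lt u v || lf v u.
have l1T : transitive l1.
  move=> v u w uv vw; have [e|ne] := eqVneq u w.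
    move: uv vw; rewrite -e /l1 => /orP[uv|uv] /orP[vu|vu].
    - by have := asym _ lti ltT _ _ uv; rewrite vu.
    - by have [_] := ex _ _ uv; rewrite vu.
    - by have [_] := ex _ _ vu; rewrite uv.
    - by have := asym _ lfi lfT _ _ uv; rewrite vu.
  case/or4P: (tot _ _ ne) => wu; rewrite /l1 ?wu ?orbT//.
    move: uv vw => /orP[uv|uv] /orP[vw|vw].
    - by have := asym _ lti ltT _ _ uv; rewrite (ltT _ _ _ vw wu).
    - by have [_] := ex _ _ (ltT _ _ _ wu uv); rewrite vw.
    - by have [_] := ex _ _ (ltT _ _ _ vw wu); rewrite uv.
    - by have [_] := ex _ _ wu; rewrite (lfT _ _ _ uv vw).
  move: uv vw => /orP[uv|uv] /orP[vw|vw].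
  - by have [_] := ex _ _ (ltT _ _ _ uv vw); rewrite wu.
  - by have [_] := ex _ _ uv; rewrite (lfT _ _ _ vw wu).
  - by have [_] := ex _ _ vw; rewrite (lfT _ _ _ wu uv).
  - by have := asym _ lfi lfT _ _ uv; rewrite (lfT _ _ _ vw wu).
have l2T : transitive l2.
  move=> v u w uv vw; have [e|ne] := eqVneq u w.
    move: uv vw; rewrite -e /l2 => /orP[uv|uv] /orP[vu|vu].
    - by have := asym _ lti ltT _ _ uv; rewrite vu.
    - by have [+ _] := ex _ _ uv; rewrite vu.
    - by have [+ _] := ex _ _ vu; rewrite uv.
    - by have := asym _ lfi lfT _ _ uv; rewrite vu.
  case/or4P: (tot _ _ ne) => wu; rewrite /l2 ?wu ?orbT//.
    move: uv vw => /orP[uv|uv] /orP[vw|vw].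
    - by have := asym _ lti ltT _ _ uv; rewrite (ltT _ _ _ vw wu).
    - by have [+ _] := ex _ _ (ltT _ _ _ wu uv); rewrite vw.
    - by have [+ _] := ex _ _ (ltT _ _ _ vw wu); rewrite uv.
    - by have [+ _] := ex _ _ wu; rewrite (lfT _ _ _ vw uv).
  move: uv vw => /orP[uv|uv] /orP[vw|vw].
  - by have [+ _] := ex _ _ (ltT _ _ _ uv vw); rewrite wu.
  - by have [+ _] := ex _ _ uv; rewrite (lfT _ _ _ wu vw).
  - by have [+ _] := ex _ _ vw; rewrite (lfT _ _ _ uv wu).
  - by have := asym _ lfi lfT _ _ uv; rewrite (lfT _ _ _ wu vw).
have [x ix xE] : exists2 x : W -> int, injective x & forall u v, (x u < x v) = l1 u v.
  apply: strict_total_order_rank => // [u|u v /tot].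
    by rewrite /l1 lti lfi.
  by rewrite /l1; do 4![case/orP || move] => ->; rewrite ?orbT.
have [y iy yE] : exists2 y : W -> int, injective y & forall u v, (y u < y v) = l2 u v.
  apply: strict_total_order_rank => // [u|u v /tot].
    by rewrite /l2 lti lfi.
  by rewrite /l2; do 4![case/orP || move] => ->; rewrite ?orbT.
exists x, y; split=> // u v; rewrite xE yE /l1 /l2 -orb_andr.
apply/orb_idr => /andP[uv vu].
by have := asym _ lfi lfT _ _ uv; rewrite vu.
Qed.

(* Each element occupies the closed interval [lo, hi] of heights, which is a point for
   a vertex, and has abscissa [X w s] at height [s]. *)
Section Sweep.
Variables (R : realDomainType) (W : finType) (lo hi : W -> R) (X : W -> R -> R).
Implicit Types u v w z : W.

Definition spans w s := lo w <= s <= hi w.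

Hypothesis lo_hi : forall w, lo w <= hi w.
Hypothesis X_consistent : forall u v s1 s2, spans u s1 -> spans v s1 ->
  spans u s2 -> spans v s2 -> X u s1 < X v s1 -> X u s2 <= X v s2.
Hypothesis X_overlap : forall u v, u != v -> lo u < hi v -> lo v < hi u ->
  exists s, [/\ spans u s, spans v s & X u s != X v s].
Hypothesis X_level : forall u v, u != v -> hi u <= lo v -> hi v <= lo u ->
  X u (lo u) != X v (lo u).

Definition beside u v := `[< exists s, [/\ spans u s, spans v s & X u s < X v s] >].

Lemma beside_asym u v : beside u v -> ~~ beside v u.
Proof.
move=> /asboolP[s [us vs uv]]; apply/asboolP => -[s' [vs' us' vu]].
by have := X_consistent us vs us' vs' uv; rewrite leNgt vu.
Qed.

Lemma beside_irr u : ~~ beside u u.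
Proof. by apply/negP => uu; have := beside_asym uu; rewrite uu. Qed.

(** At the larger of the two witnessing heights all three elements are present, since [u] and [w]
    reach at least as high as [v]. *)
Lemma beside_shortcut u v w : beside u v -> beside v w -> hi v <= hi u -> hi v <= hi w ->
  beside u w.
Proof.
move=> /asboolP[s [us vs uv]] /asboolP[s' [vs' ws' vw]] vu vw'; apply/asboolP.
move: us vs vs' ws'; rewrite /spans => /andP[us us'] /andP[vs vs_] /andP[vs' vs_'] /andP[ws' ws_'].
have [ss|/ltW ss] := leP s s'.
  have u' : lo u <= s' <= hi u by rewrite (le_trans us) // (le_trans vs_').
  exists s'; rewrite /spans u' ws' ws_'; split=> //; apply: le_lt_trans vw.
  by apply: X_consistent uv => //; rewrite /spans ?us ?us' ?vs ?vs_ ?vs' ?vs_'.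
have w' : lo w <= s <= hi w by rewrite (le_trans ws') // (le_trans vs_).
exists s; rewrite /spans us us' w'; split=> //; apply: lt_le_trans uv _.
by apply: X_consistent vw => //; rewrite /spans ?ws' ?ws_' ?vs ?vs_ ?vs' ?vs_'.
Qed.

(* Deleting from a cycle the element whose top is lowest leaves a shorter cycle. *)
Lemma beside_acyclic c : cycle beside c -> c = [::].
Proof.
have [n] := ubnP (size c); elim: n c => // n IH [//|a c] cn cc.
have aac : a \in a :: c by rewrite mem_head.
case: (Order.TotalTheory.arg_minP (P := mem (a :: c)) hi aac) => v vc vmin.
have [i s cs] := rot_to vc.
have : cycle beside (v :: s) by rewrite -cs rot_cycle.
have mems w : w \in v :: s -> hi v <= hi w by rewrite -cs mem_rot => /vmin.
have sn : (size s < n)%N by have := congr1 size cs; rewrite size_rot /=; move: cn => /=; lia.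
case: s sn mems {cs} => [|w s] sn mems /=; first by rewrite (negbTE (beside_irr v)).
rewrite rcons_path => /and3P[vw ws sv].
suff : w :: s = [::] by [].
apply: IH => //=; rewrite rcons_path ws /=; apply: (beside_shortcut sv vw).
  by apply: mems; rewrite inE mem_last orbT.
by apply: mems; rewrite !inE eqxx orbT.
Qed.

Lemma connect_beside_anti u v : connect beside u v -> connect beside v u -> u = v.
Proof.
move=> /connectP[p up ->] /connectP[q vq eu]; case/lastP: p up vq eu => // p z.
rewrite last_rcons => pz zq eu.
suff : u :: p ++ (z :: q) = [::] by [].
have : path beside u ((rcons p z) ++ q) by rewrite cat_path pz last_rcons.
case/lastP: q zq eu => [|q w] /=; rewrite ?last_rcons => zq eu.
  rewrite cats0 -eu => /(@beside_acyclic (u :: p)); by [].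
by rewrite -rcons_cat -eu => /(@beside_acyclic (u :: rcons p z ++ q)).
Qed.

(** As [beside] only relates elements with a common height, its transitive closure is taken. Pairs
    left unrelated by it are ordered by height. *)
Definition sweep_left u v := connect beside u v && (u != v).
Definition sweep_below u v :=
  [&& u != v, ~~ connect beside u v, ~~ connect beside v u & hi u <= lo v].

Lemma sweep_left_trans : transitive sweep_left.
Proof.
move=> v u w /andP[uv nuv] /andP[vw nvw]; rewrite /sweep_left (connect_trans uv vw).
apply: contraNneq nuv => uw; rewrite uw in uv *; apply/eqP.
exact: connect_beside_anti uv vw.
Qed.

Lemma unrelated_apart u v : u != v -> ~~ beside u v -> ~~ beside v u ->
  (hi u <= lo v) || (hi v <= lo u).
Proof.
move=> ne nuv nvu; case: leP => //= uv; case: leP => //= vu.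
have [s [us vs]] := X_overlap ne vu uv.
rewrite neq_lt => /orP[] lt; [move/negP: nuv|move/negP: nvu]; case; apply/asboolP;
  by exists s.
Qed.

Lemma unrelated_not_level u v : u != v -> ~~ beside u v -> ~~ beside v u ->
  ~~ ((hi u <= lo v) && (hi v <= lo u)).
Proof.
move=> ne nuv nvu; apply/negP => /andP[uv vu].
have [lu lv] := (lo_hi u, lo_hi v).
have mu : spans u (lo u) by rewrite /spans lexx.
have mv : spans v (lo u) by rewrite /spans (le_trans lv vu) (le_trans (le_trans lu uv)).
have := X_level ne uv vu; rewrite neq_lt => /orP[] lt;
  [move/negP: nuv|move/negP: nvu]; case; apply/asboolP; by exists (lo u).
Qed.

(** If [z] ended below [v] and [w] started above it, their common height would be [lo v]. Neither is
    beside [v], so both would have the abscissa of [v] there. *)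
Lemma beside_same_side v z w : z != v -> w != v -> ~~ beside z v -> ~~ beside v z ->
  ~~ beside w v -> ~~ beside v w -> beside z w || beside w z ->
  hi z <= lo v -> hi w <= lo v.
Proof.
move=> zv wv nzv nvz nwv nvw zw lz.
case/orP: (unrelated_apart wv nwv nvw) => // vw.
have [s [sz sw ne]] : exists s, [/\ spans z s, spans w s & X z s != X w s].
  by case/orP: zw => /asboolP[s [? ? lt]]; exists s; split=> //; rewrite neq_lt lt ?orbT.
have es : s = lo v.
  apply/le_anti; rewrite (le_trans _ lz); last by case/andP: sz.
  by rewrite (le_trans (lo_hi v)) // (le_trans vw) //; case/andP: sw.
have sv : spans v s by rewrite /spans es lexx lo_hi.
have eqX u : spans u s -> ~~ beside u v -> ~~ beside v u -> X u s = X v s.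
  move=> us /asboolP nuv /asboolP nvu; apply/le_anti; rewrite !leNgt.
  by apply/andP; split; apply/negP => lt; [apply: nvu|apply: nuv]; exists s.
by move: ne; rewrite (eqX z) // (eqX w) // eqxx.
Qed.

Lemma sweep_belowN v u : sweep_below u v -> ~~ beside u v /\ ~~ beside v u.
Proof.
by move=> /and4P[_ uv vu _]; split; [apply: contra uv|apply: contra vu]; apply: connect1.
Qed.

Lemma sweep_below_trans : transitive sweep_below.
Proof.
move=> v u w luv lvw; have [/and4P[uv cuv cvu hu] /and4P[vw cvw cwv hv]] := (luv, lvw).
(* Along a chain avoiding everything related to [v], no element can jump over [v]. *)
have unr z z' : connect beside z z' -> (z = u \/ z = w) -> (z' = u \/ z' = w) ->
    forall p, path beside z p -> last z p = z' ->
    forall a, a \in z :: p -> [/\ a != v, ~~ beside a v & ~~ beside v a].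
  move=> _ zE z'E p zp pz' a ap.
  have [za az'] : connect beside z a /\ connect beside a z'.
    by move: ap => /splitPl ap; case: ap zp pz' => p1 p2 <-; rewrite cat_path last_cat =>
      /andP[zp1 ap2] <-; split; apply/connectP; [exists p1|exists p2].
  have nv y : (y = u \/ y = w) -> ~~ connect beside y v /\ ~~ connect beside v y.
    by case=> ->.
  have [nzv _] := nv _ zE; have [_ nvz'] := nv _ z'E; split.
  - by apply: contraNneq nzv => <-.
  - by apply: contra nzv => /connect1; apply: connect_trans.
  - by apply: contra nvz' => /connect1 va; apply: connect_trans va az'.
have low z p : hi z <= lo v -> path beside z p ->
    (forall a, a \in z :: p -> [/\ a != v, ~~ beside a v & ~~ beside v a]) ->
    hi (last z p) <= lo v.
  elim: p z => //= a p IH z hz /andP[za ap] H; apply: IH => //; last first.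
    by move=> b bp; apply: H; rewrite inE bp orbT.
  have [zv nzv nvz] := H z (mem_head _ _).
  have [av nav nva] : [/\ a != v, ~~ beside a v & ~~ beside v a].
    by apply: H; rewrite !inE eqxx orbT.
  by apply: (beside_same_side zv av) => //; rewrite za.
have high z p : ~~ (hi z <= lo v) -> path beside z p ->
    (forall a, a \in z :: p -> [/\ a != v, ~~ beside a v & ~~ beside v a]) ->
    ~~ (hi (last z p) <= lo v).
  elim: p z => //= a p IH z hz /andP[za ap] H; apply: IH => //; last first.
    by move=> b bp; apply: H; rewrite inE bp orbT.
  have [zv nzv nvz] := H z (mem_head _ _).
  have [av nav nva] : [/\ a != v, ~~ beside a v & ~~ beside v a].
    by apply: H; rewrite !inE eqxx orbT.
  by apply: contra hz; apply: (beside_same_side av zv) => //; rewrite za orbT.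
have nw : ~~ (hi w <= lo v).
  have [nvw nwv] := sweep_belowN lvw.
  by apply: contra (unrelated_not_level vw nvw nwv) => ->; rewrite hv.
have cuw : ~~ connect beside u w.
  apply/negP => cuw; have /connectP[p up ew] := cuw.
  move/negP: nw; apply; rewrite ew; apply: (low u p hu up).
  exact: (unr u w cuw (or_introl erefl) (or_intror erefl) p up (esym ew)).
have cwu : ~~ connect beside w u.
  apply/negP => cwu; have /connectP[p wp eu] := cwu.
  have := high w p nw wp (unr w u cwu (or_intror erefl) (or_introl erefl) p wp (esym eu)).
  by rewrite -eu hu.
rewrite /sweep_below cuw cwu (le_trans hu) ?(le_trans (lo_hi v)) // ?andbT.
by apply: contraNneq cuw => ->; apply: connect0.
Qed.

(* [a] stands for an endpoint of the edge [e]. As heights are closed intervals, [e] is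
   beside everything that [a] is beside. *)
Section Touching.
Variables a e : W.
Hypothesis ae : a != e.
Hypothesis right_touch : forall z, beside a z -> beside e z.
Hypothesis left_touch : forall z, beside z a -> beside z e.

Lemma touching_from w : a != w -> connect beside a w -> connect beside e w.
Proof.
move=> aw /connectP[[|z p] /=]; first by move=> _ E; rewrite E eqxx in aw.
move=> /andP[/right_touch ez zp] ->; apply: connect_trans (connect1 ez) _.
by apply/connectP; exists p.
Qed.

Lemma touching_to w : a != w -> connect beside w a -> connect beside w e.
Proof.
move=> aw /connectP[p]; case/lastP: p => [|p z] /=.
  by move=> _ E; rewrite E eqxx in aw.
rewrite last_rcons rcons_path => /andP[wp pz] E; rewrite -E in pz.
apply: connect_trans (connect1 (left_touch pz)).
by apply/connectP; exists p.
Qed.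

(** The first step of a chain from [a] to [e] is also to the right of [e], which would close a
    cycle. *)
Lemma touching_from_self : ~~ connect beside a e.
Proof.
apply/negP => /connectP[[|z p] /=]; first by move=> _ E; move: ae; rewrite E eqxx.
move=> /andP[/right_touch ez zp] E; have ze : connect beside z e by apply/connectP; exists p.
by have zE := connect_beside_anti ze (connect1 ez); move: ez; rewrite zE (negbTE (beside_irr e)).
Qed.

Lemma touching_to_self : ~~ connect beside e a.
Proof.
apply/negP => /connectP[p]; case/lastP: p => [|p z] /=.
  by move=> _ E; move: ae; rewrite E eqxx.
rewrite last_rcons rcons_path => /andP[ep pz] E; rewrite -E in pz.
have ez : connect beside e (last e p) by apply/connectP; exists p.
have lz := left_touch pz; have zE := connect_beside_anti ez (connect1 lz).
by move: lz; rewrite -zE (negbTE (beside_irr e)).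
Qed.

Lemma touching_below : hi a <= lo e -> sweep_below a e.
Proof. by move=> le; rewrite /sweep_below ae touching_from_self touching_to_self. Qed.

Lemma touching_above : hi e <= lo a -> sweep_below e a.
Proof. by move=> le; rewrite /sweep_below eq_sym ae touching_from_self touching_to_self. Qed.

(** Any chain between [w] and [a] would yield one between [w] and [e]. *)
Lemma below_touching w : lo e <= lo a -> w != a -> sweep_below w e -> sweep_below w a.
Proof.
move=> le wa /and4P[_ we ew /le_trans H]; rewrite /sweep_below wa H //= andbT.
by apply/andP; split; [apply: contra we; apply: touching_to|
  apply: contra ew; apply: touching_from]; rewrite eq_sym.
Qed.

Lemma above_touching w : hi a <= hi e -> w != a -> sweep_below e w -> sweep_below a w.
Proof.
move=> le wa /and4P[_ ew we H]; rewrite /sweep_below eq_sym wa (le_trans le H) //= andbT.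
by apply/andP; split; [apply: contra ew; apply: touching_from|
  apply: contra we; apply: touching_to]; rewrite eq_sym.
Qed.

End Touching.

Lemma sweep_below_irr : irreflexive sweep_below.
Proof. by move=> u; rewrite /sweep_below eqxx. Qed.

Lemma sweep_left_irr : irreflexive sweep_left.
Proof. by move=> u; rewrite /sweep_left eqxx andbF. Qed.

Lemma sweep_below_left u v : sweep_below u v -> ~~ sweep_left u v /\ ~~ sweep_left v u.
Proof. by move=> /and4P[_ uv vu _]; rewrite /sweep_left !negb_and uv vu. Qed.

Lemma sweep_total u v : u != v ->
  [|| sweep_below u v, sweep_below v u, sweep_left u v | sweep_left v u].
Proof.
move=> ne; rewrite /sweep_below /sweep_left ne eq_sym ne.
case uv: (connect beside u v); rewrite ?orbT//=.
case vu: (connect beside v u); rewrite ?orbT//= !orbF.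
by apply: unrelated_apart => //; [move/negbT: uv|move/negbT: vu]; apply: contra; apply: connect1.
Qed.

Lemma sweep_coordinates : exists x y : W -> int, [/\ injective x, injective y &
  forall u v, (x u < x v) && (y u < y v) = sweep_below u v].
Proof.
apply: conjugate_coordinates sweep_left_irr sweep_below_trans sweep_left_trans
  sweep_below_left sweep_total.
exact: sweep_below_irr.
Qed.

End Sweep.

(** * Upward curves as graphs over the height *)

Section Drawings.
Local Open Scope classical_set_scope.
Local Open Scope ring_scope.

Lemma upward_curve_graph (R : realType) (p q : R * R) (c : R -> R * R) :
  upward_curve p q c -> exists f : R -> R,
    [/\ p.2 < q.2, {within `[p.2, q.2], continuous f}, f p.2 = p.1, f q.2 = q.1 &
     forall s, p.2 <= s <= q.2 -> curve_image c (f s, s)].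
Proof.
move=> [cc c0 c1 cm]; pose k s := (c s).2.
have k01 : k 0 < k 1 by apply: cm.
have kc : {within `[0, 1], continuous k}.
  apply: (@within_continuous_comp _ _ _ _ c snd) => // x _; exact: cvg_snd.
have c1c : {within `[0, 1], continuous (fst \o c)}.
  apply: (@within_continuous_comp _ _ _ _ c fst) => // x _; exact: cvg_fst.
have kinj : {in `[0, 1] &, injective k}.
  move=> s s' /itvP s01 /itvP s'01 ss'; case: (ltgtP s s') => // lt.
    suff : k s < k s' by rewrite ss' ltxx.
    by apply: cm; rewrite ?s01 ?s'01.
  suff : k s' < k s by rewrite ss' ltxx.
  by apply: cm; rewrite ?s01 ?s'01.
have kmono s s' : 0 <= s -> s <= s' -> s' <= 1 -> k s <= k s'.
  move=> s0; rewrite le_eqVlt => /orP[/eqP->//|ss' s'1].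
  by apply/ltW/cm.
(* [g] inverts the strictly increasing height [k] of the curve; reparametrising by [g] turns the
   curve into a graph over the height. *)
have /choice[g gP] : forall s, exists r, k 0 <= s <= k 1 -> (0 <= r <= 1) /\ k r = s.
  move=> s; have [sk|] := boolP (k 0 <= s <= k 1); last by exists 0.
  have [|r + rs] := IVT ler01 kc (v := s).
    by rewrite (min_idPl (ltW k01)) (max_idPr (ltW k01)).
  by rewrite in_itv /= => r01; exists r.
have gk : {in `[0, 1], cancel k g}.
  move=> s s01; have [|g01 kg] := gP (k s).
    by have /itvP s01' := s01; rewrite !kmono// s01'.
  by apply: kinj => //; rewrite in_itv.
have gc : {within `[k 0, k 1], continuous g} := segment_can_le_continuous ler01 kc gk.
have pk : p.2 = k 0 by rewrite /k c0.
have qk : q.2 = k 1 by rewrite /k c1.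
exists (fun s => (c (g s)).1); rewrite pk qk; split=> //.
- apply/subspace_continuousP => s; rewrite /= in_itv /= => sk W.
  have [g01 kg] := gP _ sk.
  move: c1c => /subspace_continuousP/(_ (g s)); rewrite /= in_itv /= => /(_ g01 W) cW.
  move=> /cW gW; have := gc => /subspace_continuousP/(_ s).
  rewrite /= in_itv /= => /(_ sk _ gW) gW'.
  suff : within `[k 0, k 1] (nbhs s) (fun s' => W (c (g s')).1) by [].
  apply: (@filterS _ (nbhs s) _ _ _ _ gW') => s' H s'k; apply: H => //.
  by move: s'k; rewrite /= !in_itv /= => /gP[].
- by rewrite gk ?in_itv/= ?lexx ?ler01// c0.
- by rewrite gk ?in_itv/= ?lexx ?ler01// c1.
- move=> s /gP[g01 kg]; exists (g s); first by rewrite /= in_itv.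
  by rewrite -[X in (_, X)]kg /k -surjective_pairing.
Qed.

Notation dag_edges G := {e : vertex G * vertex G | edge e.1 e.2}.

Section Drawing.
Variables (R : realType) (G : dag) (pos : G -> R * R) (curve : G * G -> R -> R * R).
Hypothesis drawn : upward_planar_drawing pos curve.

Local Notation dag_edge := (dag_edges G).
Definition dag_tail (e : dag_edge) : G := (val e).1.
Definition dag_head (e : dag_edge) : G := (val e).2.

Variable f : dag_edge -> R -> R.
Hypothesis fP : forall e, let p := pos (dag_tail e) in let q := pos (dag_head e) in
  [/\ p.2 < q.2, {within `[p.2, q.2], continuous (f e)}, f e p.2 = p.1,
      f e q.2 = q.1 &
      forall s, p.2 <= s <= q.2 -> curve_image (curve (val e)) (f e s, s)].

Local Notation W := (G + dag_edge)%type.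

Definition lowest (w : W) : R :=
  match w with inl v => (pos v).2 | inr e => (pos (dag_tail e)).2 end.
Definition highest (w : W) : R :=
  match w with inl v => (pos v).2 | inr e => (pos (dag_head e)).2 end.
Definition abscissa (w : W) (s : R) : R :=
  match w with inl v => (pos v).1 | inr e => f e s end.

Local Notation spans := (spans lowest highest).

Lemma lowest_highest w : lowest w <= highest w.
Proof. by case: w => //= e; have [/ltW] := fP e. Qed.

Lemma edge_interior e s : (pos (dag_tail e)).2 < s < (pos (dag_head e)).2 ->
  forall p : R * R, p.2 = s -> p <> pos (dag_tail e) /\ p <> pos (dag_head e).
Proof.
move=> /andP[s1 s2] p ps; split=> pe; [move: s1|move: s2];
  by rewrite -ps pe ltxx.
Qed.

Lemma edges_disjoint e e' s : e != e' -> (pos (dag_tail e)).2 < s < (pos (dag_head e)).2 ->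
  (pos (dag_tail e')).2 <= s <= (pos (dag_head e')).2 -> f e s != f e' s.
Proof.
move=> ee' es es'; apply/eqP => fe; have [_ _ _ dis] := drawn.
have [/andP[/ltW s1 /ltW s2] [ne1 ne2]] := (es, edge_interior es (erefl (f e s, s).2)).
have [_ _ _ _ /(_ s)] := fP e; rewrite s1 s2 => /(_ isT) ce.
have [_ _ _ _ /(_ s es')] := fP e'; rewrite -fe => ce'.
have [|//] := dis (val e) (val e') (valP e) (valP e') _ (f e s, s) (conj ce ce').
  by move=> /val_inj E; rewrite E eqxx in ee'.
by case.
Qed.

Lemma vertex_off_edge v e : (pos (dag_tail e)).2 < (pos v).2 < (pos (dag_head e)).2 ->
  (pos v).1 != f e (pos v).2.
Proof.
move=> ve; apply/eqP => fe; have [_ _ off _] := drawn.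
have [/andP[/ltW s1 /ltW s2] [ne1 ne2]] := (ve, edge_interior ve (erefl (pos v).2)).
have [_ _ _ _ /(_ (pos v).2)] := fP e; rewrite s1 s2 => /(_ isT).
rewrite -fe -surjective_pairing => /(off _ _ (valP e)) [] E; [apply: ne1|apply: ne2];
  by rewrite E.
Qed.

(** A vertex has only one height. Two edges that change sides meet, by the intermediate value
    theorem, strictly between the two heights, hence in the interior of both. *)
Lemma abscissa_consistent u v s1 s2 : spans u s1 -> spans v s1 -> spans u s2 ->
  spans v s2 -> abscissa u s1 < abscissa v s1 -> abscissa u s2 <= abscissa v s2.
Proof.
case: u => [a|e]; case: v => [b|e'] //=; rewrite /spans /=.
- by move=> _ _ _ _ /ltW.
- by move=> /le_anti<- _ /le_anti<- _ /ltW.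
- by move=> _ /le_anti<- _ /le_anti<- /ltW.
move=> us1 vs1 us2 vs2 lt; have [E|ee'] := eqVneq e e'; first by rewrite E ltxx in lt.
rewrite leNgt; apply/negP => gt.
pose a := Num.min s1 s2; pose b := Num.max s1 s2.
have ab : a <= b by rewrite ge_min !le_max lexx.
have sub d : (pos (dag_tail d)).2 <= s1 <= (pos (dag_head d)).2 ->
    (pos (dag_tail d)).2 <= s2 <= (pos (dag_head d)).2 ->
    (pos (dag_tail d)).2 <= a /\ b <= (pos (dag_head d)).2.
  by move=> /andP[? ?] /andP[? ?]; rewrite le_min ge_max; split; apply/andP.
have cont d : (pos (dag_tail d)).2 <= s1 <= (pos (dag_head d)).2 ->
    (pos (dag_tail d)).2 <= s2 <= (pos (dag_head d)).2 ->
    {within `[a, b], continuous (f d)}.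
  move=> d1 d2; have [da db] := sub d d1 d2.
  have [_ + _ _ _] := fP d; apply: continuous_subspaceW => s /=.
  by rewrite !in_itv /= => /andP[/(le_trans da)-> sb]; rewrite (le_trans sb).
have [||s + /eqP] := IVT (f := f e - f e') (v := 0) ab.
- exact: (within_continuousB (cont _ us1 us2) (cont _ vs1 vs2)).
- rewrite /a /b /=; have [ss|ss] := leP s1 s2; rewrite ge_min le_max !subr_le0 !subr_ge0;
    by rewrite (ltW lt) (ltW gt) ?orbT.
rewrite in_itv /= subr_eq0 => /andP[sa sb] /eqP fs.
have [ns1 ns2] : s != s1 /\ s != s2.
  by split; apply/eqP => E; [move: lt|move: gt]; rewrite -E fs ltxx.
have : a < s < b.
  rewrite /a /b gt_min lt_max !lt_neqAle; move: sa sb; rewrite ge_min le_max.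
  rewrite ns1 ns2 ![_ == s]eq_sym ns1 ns2 /=.
  by move=> /orP[->|->] /orP[->|->]; rewrite ?orbT.
have [ea eb] := sub e us1 us2 => /andP[/(le_lt_trans ea) s1' /lt_le_trans/(_ eb) s2'].
have [va vb] := sub e' vs1 vs2.
have := @edges_disjoint e e' s ee'; rewrite s1' s2' fs eqxx (le_trans va)// (le_trans sb)//.
by move=> /(_ isT isT).
Qed.

Lemma abscissa_overlap u v : u != v -> lowest u < highest v -> lowest v < highest u ->
  exists s, [/\ spans u s, spans v s & abscissa u s != abscissa v s].
Proof.
case: u => [a|e]; case: v => [b|e'] /=; rewrite /spans /=.
- by move=> _ ab /(lt_trans ab); rewrite ltxx.
- move=> _ ae ea; exists (pos a).2; rewrite lexx (ltW ae) (ltW ea); split=> //.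
  by apply: vertex_off_edge; rewrite ea ae.
- move=> _ ea ae; exists (pos b).2; rewrite lexx (ltW ae) (ltW ea); split=> //.
  by rewrite eq_sym; apply: vertex_off_edge; rewrite ea ae.
move=> ee' ef fe.
have {}ee' : e != e' by apply: contraNneq ee' => ->.
have [ee _ _ _ _] := fP e; have [ff _ _ _ _] := fP e'.
pose a := Num.max (pos (dag_tail e)).2 (pos (dag_tail e')).2.
pose b := Num.min (pos (dag_head e)).2 (pos (dag_head e')).2.
have ab : a < b by rewrite /a /b lt_min !gt_max ee ef fe ff.
have := midf_lt ab; set s := (a + b) / 2 => -[].
rewrite /a /b gt_max lt_min => /andP[s1 s2] /andP[s3 s4]; exists s.
rewrite !(ltW s1, ltW s2, ltW s3, ltW s4); split=> //.
by apply: edges_disjoint => //; rewrite ?s1 ?s3 ?(ltW s2) ?(ltW s4).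
Qed.

Lemma abscissa_level u v : u != v -> highest u <= lowest v -> highest v <= lowest u ->
  abscissa u (lowest u) != abscissa v (lowest u).
Proof.
have edge_lt (e : dag_edge) : lowest (inr e) < highest (inr e) by have [] := fP e.
have le := lowest_highest; case: u => [a|e]; case: v => [b|e'] uv H1 H2.
- apply: contra uv => /eqP /= E; apply/eqP; congr inl; have [inj _ _ _] := drawn.
  by apply: inj; rewrite [LHS]surjective_pairing [RHS]surjective_pairing E; congr pair;
     apply/le_anti; rewrite H1 H2.
- by move: (lt_le_trans (edge_lt e') H2); rewrite ltNge H1.
- by move: (lt_le_trans (edge_lt e) H1); rewrite ltNge H2.
- by move: (lt_le_trans (edge_lt e) H1); rewrite ltNge (le_trans (le _) H2).
Qed.

Lemma drawing_planar : exists x y : W -> int,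
  planar dag_tail dag_head (finset.setTfor dag_edge) x y.
Proof.
have [x [y [ix iy xy]]] :=
  sweep_coordinates lowest_highest abscissa_consistent abscissa_overlap abscissa_level.
have tail_at e : spans (inr e) (lowest (inl (dag_tail e))).
  by rewrite /spans lexx; apply: (lowest_highest (inr e)).
have head_at e : spans (inr e) (lowest (inl (dag_head e))).
  by rewrite /spans lexx andbT; apply: (lowest_highest (inr e)).
(* An edge passes through its endpoints, so it inherits all their [beside] relations. *)
have touch v e s : f e (pos v).2 = (pos v).1 -> spans (inr e) (pos v).2 ->
    spans (inl v) s -> f e s = (pos v).1 /\ spans (inr e) s.
  by move=> fv ev; rewrite /spans /= => /le_anti<-.
have rt v e : f e (pos v).2 = (pos v).1 -> spans (inr e) (pos v).2 ->
    forall z, beside lowest highest abscissa (inl v) z ->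
      beside lowest highest abscissa (inr e) z.
  move=> fv ev z /asboolP[s [vs zs lt]]; have [fs es] := touch v e s fv ev vs.
  by apply/asboolP; exists s; split=> //=; rewrite fs.
have lt v e : f e (pos v).2 = (pos v).1 -> spans (inr e) (pos v).2 ->
    forall z, beside lowest highest abscissa z (inl v) ->
      beside lowest highest abscissa z (inr e).
  move=> fv ev z /asboolP[s [zs vs lt]]; have [fs es] := touch v e s fv ev vs.
  by apply/asboolP; exists s; split=> //=; rewrite fs.
have rtt e := rt (dag_tail e) e (let: And5 _ _ a _ _ := fP e in a) (tail_at e).
have ltt e := lt (dag_tail e) e (let: And5 _ _ a _ _ := fP e in a) (tail_at e).
have rth e := rt (dag_head e) e (let: And5 _ _ _ a _ := fP e in a) (head_at e).
have lth e := lt (dag_head e) e (let: And5 _ _ _ a _ := fP e in a) (head_at e).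
exists x, y; split.
- by move=> u v _ _; apply: ix.
- by move=> u v _ _; apply: iy.
- move=> e _; rewrite /below xy.
  by apply: (touching_below abscissa_consistent _ (rtt e) (ltt e)).
- move=> e _; rewrite /below xy.
  by apply: (touching_above abscissa_consistent _ (rth e) (lth e)).
- move=> e w _ _; rewrite /below xy => we.
  have [->|ne] := eqVneq w (inl (dag_tail e)); first by rewrite /weakly_below !lexx.
  have := below_touching (rtt e) (ltt e) (lexx _) ne we.
  by rewrite -xy /weakly_below => /andP[/ltW-> /ltW->].
- move=> e w _ _; rewrite /below xy => we.
  have [->|ne] := eqVneq w (inl (dag_head e)); first by rewrite /weakly_below !lexx.
  have := above_touching (rth e) (lth e) (lexx _) ne we.
  by rewrite -xy /weakly_below => /andP[/ltW-> /ltW->].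
Qed.

End Drawing.

Lemma upward_planar_pages (R : realType) (G : dag) (k L : nat) :
  upward_planar R G -> (0 < k)%N -> (#|G| <= 2 ^ L)%N ->
  exists2 K : nat, (k ^ 2 * K <= #|G| ^ 2)%N &
    (page_number G <= 2 * (12 * k).+1 * L + 4 * K)%N.
Proof.
move=> [pos [curve drawn]] k0 GL.
have /choice[f fP] : forall e : dag_edges G, exists f : R -> R,
    let p := pos (dag_tail e) in let q := pos (dag_head e) in
    [/\ p.2 < q.2, {within `[p.2, q.2], continuous f}, f p.2 = p.1,
      f q.2 = q.1 &
      forall s, p.2 <= s <= q.2 -> curve_image (curve (val e)) (f s, s)].
  by move=> e; apply: upward_curve_graph; have [_ H _ _] := drawn; apply/H/(valP e).
have [x [y P]] := drawing_planar drawn fP.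
have [z [c [K [iz ez kK cK cz]]]] := planar_pages k0 GL P.
exists K => //; rewrite /page_number; case: ex_minnP => m _; apply; apply/asboolP.
exists (fun u v => z u < z v), (fun e => if insub e is Some d then c d else 0%N).
split.
- split; first split.
  + by move=> u; rewrite ltxx.
  + by move=> v u w; apply: lt_trans.
  + move=> u v uv; rewrite -neq_lt; apply: contra uv => /eqP/iz->; exact: eqxx.
  move=> u v uv; pose e : dag_edges G := Sub (u, v) uv.
  apply: ez; have := planar_tail P (finset.in_setT e); have := planar_head P (finset.in_setT e).
  rewrite /below => /andP[h1 h2] /andP[t1 t2].
  by rewrite (lt_trans t1 h1) (lt_trans t2 h2).
- by move=> e eG; rewrite insubT; apply: cK; rewrite finset.in_setT.
move=> e e' eG e'G; rewrite !insubT => cc.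
(* [crosses] fixes which edge starts first while [cross] does not, so both orders are needed. *)
have := cz (Sub e eG) (Sub e' e'G) (finset.in_setT _) (finset.in_setT _) cc.
have := cz (Sub e' e'G) (Sub e eG) (finset.in_setT _) (finset.in_setT _) (esym cc).
rewrite /crosses /cross /dag_tail /dag_head !SubK => n1 n2.
by rewrite negb_or n1 n2.
Qed.

End Drawings.

(** * The asymptotic bound *)

Lemma trunc_log_le_ln (R : realType) n : (2 <= n)%N ->
  (trunc_log 2 n).+1%:R <= 2 / ln 2 * ln n%:R :> R.
Proof.
move=> n2; have d0 : 0 < ln 2 :> R by rewrite ln_gt0// ltr1n.
have n0 : 0 < n%:R :> R by rewrite ltr0n (leq_trans _ n2).
(* This pays for the successor and yields the factor 2. *)
have one : ln 2 <= ln n%:R :> R by rewrite ler_ln ?posrE// ?ler_nat// ltr0n.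
have log : (trunc_log 2 n)%:R * ln 2 <= ln n%:R :> R.
  rewrite mulr_natl -lnXn ?ltr0n// ler_ln ?posrE// ?exprn_gt0// ?ltr0n// -natrX ler_nat.
  by apply: trunc_logP => //; apply: leq_trans n2.
by rewrite mulrAC ler_pdivlMr// -addn1 natrD; nra.
Qed.

Theorem theorem4 (R : realType) :
  exists C : R, forall (n : nat) (G : dag),
    (2 <= n)%N -> #|G| = n -> upward_planar R G ->
    (page_number G)%:R <= C * n%:R `^ (2 / 3) * (ln n%:R) `^ (2 / 3).
Proof.
pose d : R := ln 2; have d0 : 0 < d by rewrite ln_gt0// ltr1n.
(* The first term bounds the ladder-free part: [2 * 13 * (2 / d)] from its three factors, times 2
   for rounding [k] up. The 4 comes from the paid edges. *)
exists (104 / d + 4) => n G n2 Gn Gup.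
have N1 : 1 <= n%:R :> R by rewrite ler1n (leq_trans _ n2).
have N0 : 0 < n%:R :> R by apply: lt_le_trans N1.
have l0 : 0 < ln n%:R :> R by rewrite ln_gt0// ltr1n.
pose l : R := ln n%:R; pose a := n%:R `^ (2 / 3) : R; pose b := l `^ (1 / 3).
have a0 : 0 < a by apply: powR_gt0.
have b0 : 0 < b by apply: powR_gt0.
have a3 : a ^+ 3 = n%:R ^+ 2.
  by rewrite /a -powR_mulrn ?powR_ge0// -powRrM -[RHS]powR_mulrn ?ltW//; congr powR; field.
have b3 : b ^+ 3 = l.
  by rewrite /b -powR_mulrn ?powR_ge0// -powRrM -[RHS](powRr1 (ltW l0)); congr powR; field.
have b2 : l `^ (2 / 3) = b ^+ 2.
  by rewrite /b -powR_mulrn ?powR_ge0// -powRrM; congr powR; field.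
(* Hence [a / b] is at least 1, and rounding it up to [k] at most doubles it. *)
have ba : b <= a.
  have lN : l <= n%:R by apply/ltW/ln_sublinear.
  apply: (@le_trans _ _ (n%:R `^ (1 / 3))).
    apply: ge0_ler_powR lN; rewrite ?nnegrE; [lra|exact: ltW|exact: ltW].
  by apply: ler_powR => //; lra.
rewrite -/a [X in _ <= _ * X]b2.
(* Up to rounding, [k] is [n ^ (2/3) / (ln n) ^ (1/3)], which balances [k * ln n] against
   [n ^ 2 / k ^ 2]. *)
pose k := (Num.truncn (a / b)).+1.
have [k_gt k_le] : a / b < k%:R /\ k%:R <= a / b + 1.
  have ab0 : 0 <= a / b by rewrite divr_ge0// ltW.
  split; first by rewrite /k truncnS_gt.
  by rewrite /k -addn1 natrD lerD2r truncn_le.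
have GL : (#|G| <= 2 ^ (trunc_log 2 n).+1)%N by rewrite Gn ltnW// trunc_log_ltn.
have [K kK pK] := upward_planar_pages Gup (ltn0Sn _ : (0 < k)%N) GL.
have KR : K%:R <= a * b ^+ 2.
  have : k%:R ^+ 2 * K%:R <= a ^+ 3 :> R by rewrite a3 -!natrX -natrM ler_nat -Gn.
  have : (a / b) ^+ 2 <= k%:R ^+ 2 by rewrite lerXn2r ?nnegrE ?ltW// divr_gt0.
  move=> H1 H2; have {H1 H2} : (a / b) ^+ 2 * K%:R <= a ^+ 3.
    by apply: le_trans H2; rewrite ler_wpM2r.
  move=> H; rewrite -(ler_pM2l (exprn_gt0 2 a0)).
  rewrite (_ : a ^+ 2 * (a * b ^+ 2) = a ^+ 3 * b ^+ 2); last by ring.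
  by rewrite -ler_pdivrMr ?exprn_gt0// mulrAC -expr_div_n H.
have LR := trunc_log_le_ln R n2; rewrite -/d -/l in LR.
apply: (@le_trans _ _ ((2 * (12 * k).+1 * (trunc_log 2 n).+1 + 4 * K)%N%:R)).
  by rewrite ler_nat.
have kl : k%:R * l <= 2 * (a * b ^+ 2).
  have -> : 2 * (a * b ^+ 2) = (a / b + a / b) * l.
    by rewrite -b3; field; rewrite gt_eqF.
  rewrite (ler_wpM2r (ltW l0))// (le_trans k_le)// lerD2l.
  by rewrite ler_pdivlMr// mul1r.
have big : (12 * k).+1%:R <= 13 * k%:R :> R.
  by have : (0 < k)%N by []; rewrite -natrM ler_nat; lia.
have -> : (104 / d + 4) * a * b ^+ 2 = 52 / d * (2 * (a * b ^+ 2)) + 4 * (a * b ^+ 2).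
  by ring.
rewrite natrD !natrM.
apply: lerD; last by rewrite ler_wpM2l.
apply: (@le_trans _ _ (2 * (13 * k%:R) * (2 / d * l))).
  by apply: ler_pM => //; rewrite ?mulr_ge0// ler_wpM2l.
rewrite (_ : 2 * (13 * k%:R) * (2 / d * l) = 52 / d * (k%:R * l)); last by ring.
by rewrite ler_wpM2l// divr_ge0// ltW.
Qed.
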